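(* Let $\phi:\mathbb{R}^d\to\mathbb{R}$ be continuous and symmetric ($\phi(-x)=\phi(x)$ for all $x$), with $|\phi|_\infty:=\sup_{x\in[0,1]^d}\sum_{k\in\mathbb{Z}^d}|\phi(x-k)|<\infty$ and with cardinal symbol satisfying $\sigma_\phi(\zeta)>0$ for all $\zeta\in T^d$. Let $H$ be a half-space lattice, and let $\gamma_k$ ($k\in H$) be the Fourier coefficients of the Wiener-Hopf factor $\omega_+$ and $a_{k,j}$ ($k\in H$) those of the semi-cardinal symbol $\omega_j$ ($j\in H$). (i) (Algebraic decay.) If, in addition, there exist constants $\alpha>d$ and $C_0>0$ such that $|\phi(x)|\le C_0(1+\|x\|)^{-\alpha}$ for all $x\in\mathbb{R}^d$, then there exist positive constants $C_1=C_1(\alpha,d,\phi)$, $C_2=C_2(\alpha,d,\phi)$ such that $$|\gamma_k|\le C_1(1+\|k\|)^{-\alpha},\quad k\in H,$$ $$|a_{k,j}|\le C_2(1+\|k-j\|)^{-\alpha},\quad j,k\in H.$$ (ii) (Exponential decay.) If, in addition, there exist constants $\alpha>0$ and $C_0>0$ such that $|\phi(x)|\le C_0e^{-\alpha|x|}$ for all $x\in\mathbb{R}^d$, then there exist constants $\beta\in(0,\alpha)$ and $C_1=C_1(\beta,\phi,H,d)$ such that $$|\gamma_k|\le C_1e^{-\beta|k|},\quad k\in H.$$ Also, for each $\beta'\in(0,\beta)$ there exists $C_2=C_2(\beta,\beta',\phi,H,d)$ such that $$|a_{k,j}|\le C_2e^{-\beta'|k-j|},\quad j,k\in H,$$ where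 the exponential on the right-hand side of the last inequality can be replaced by $e^{-\beta'|k'-j'|-\beta|k_d-j_d|}$ if $H=\mathbb{Z}^{d-1}\times\mathbb{Z}_+$.
   Context: Notation: $\|x\|=(x_1^2+\cdots+x_d^2)^{1/2}$ is the Euclidean norm and $|x|=|x_1|+\cdots+|x_d|$ the $1$-norm on $\mathbb{R}^d$ (the same notation $|\cdot|$ for the $1$-norm on $\mathbb{R}^{d-1}$); write $x=(x',x_d)$ with $x'\in\mathbb{R}^{d-1}$. $T^d=\{\zeta\in\mathbb{C}^d:|\zeta_1|=\dots=|\zeta_d|=1\}$, $\zeta^k=\zeta_1^{k_1}\cdots\zeta_d^{k_d}$ for $k\in\mathbb{Z}^d$, $\zeta^{-1}=(\zeta_1^{-1},\dots,\zeta_d^{-1})$. $W=W(T^d)$ is the Wiener algebra of continuous functions $u$ on $T^d$ with absolutely summable Fourier coefficients $\{\widehat u_k\}_{k\in\mathbb{Z}^d}$, $\|u\|_W=\sum_k|\widehat u_k|$. $\mathbb{Z}_+=\{0,1,2,\dots\}$. Half-space lattice: a set $H\subset\mathbb{Z}^d$ that is either $H=\mathbb{Z}^{d-1}\times\mathbb{Z}_+$, or $H=\mathbb{Z}^d_{\preceq,+}:=\{j\in\mathbb{Z}^d:0\preceq j\}$, where $\preceq$ is a linear (total) order on $\mathbb{Z}^d$ compatible with addition ($j\preceq k$ implies $j+l\preceq k+l$). Cardinal symbol: $\sigma_\phi(\zeta)=\sum_{k\in\mathbb{Z}^d}\phi(k)\zeta^k$, $\zeta\in T^d$. Under the stated assumptions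 on $\phi$, $\omega:=1/\sigma_\phi\in W$ and $\log\omega\in W$; write $\log\omega(\zeta)=\sum_{k\in\mathbb{Z}^d}\lambda_k\zeta^k$. Wiener-Hopf factor: if $H=\mathbb{Z}^{d-1}\times\mathbb{Z}_+$, let $\Lambda_+(\zeta)=\frac12\sum_{k'\in\mathbb{Z}^{d-1}}\lambda_{(k',0)}(\zeta')^{k'}+\sum_{k_d=1}^\infty\sum_{k'\in\mathbb{Z}^{d-1}}\lambda_k\zeta^k$; if $H=\mathbb{Z}^d_{\preceq,+}$, let $\Lambda_+(\zeta)=\frac12\lambda_0+\sum_{k\succ0}\lambda_k\zeta^k$. Set $\omega_+=\exp(\Lambda_+)$. Then $\omega(\zeta)=\omega_+(\zeta)\omega_+(\zeta^{-1})$, $\omega_+\in W$, and its Fourier coefficients are supported on $H$: $\omega_+(\zeta)=\sum_{k\in H}\gamma_k\zeta^k$. Semi-cardinal symbols: let $P_+\{\sum_{k\in\mathbb{Z}^d}\widehat\psi_k\zeta^k\}=\sum_{k\in H}\widehat\psi_k\zeta^k$ for $\psi\in W$. For $j\in H$, $\omega_j(\zeta):=\omega_+(\zeta)\,P_+\{\zeta^j\omega_+(\zeta^{-1})\}$, which lies in $W$ with Fourier coefficients supported on $H$: $\omega_j(\zeta)=\sum_{k\in H}a_{k,j}\zeta^k$. *)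

(* Defs.v *)
From HB Require Import structures.
From mathcomp Require Import all_boot all_order all_algebra.
From mathcomp Require Import all_classical all_reals all_analysis.
From mathcomp Require Import complex.

Set Implicit Arguments.
Unset Strict Implicit.
Unset Printing Implicit Defensive.

Import Order.TTheory GRing.Theory Num.Theory.
Import numFieldNormedType.Exports.

Local Open Scope classical_set_scope.
Local Open Scope complex_scope.
Local Open Scope ring_scope.

(* The dimension is d = n.+1 where a last coordinate is needed; x_d is then
   [x ord0 ord_max] and x' is [col' ord_max x]. *)

Section Norms.
Variable R : realType.

Definition norm2 (m : nat) (x : 'rV[R]_m) : R :=
  Num.sqrt (\sum_(i < m) x ord0 i ^+ 2).

Definition norm1 (m : nat) (x : 'rV[R]_m) : R := \sum_(i < m) `|x ord0 i|.

Definition of_lattice (m : nat) (k : 'rV[int]_m) : 'rV[R]_m := map_mx intr k.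

End Norms.

Section Series.
Variable R : realType.

(* Sum of an absolutely convergent family; library infinite sums are [esum]s
   of nonnegative extended reals, hence the split into positive and negative
   parts. *)
Definition rsum (T : choiceType) (D : set T) (f : T -> R) : R :=
  fine (\esum_(k in D) ((EFin \o f)^\+ k)%E
        - \esum_(k in D) ((EFin \o f)^\- k)%E)%E.

Definition csum (T : choiceType) (D : set T) (f : T -> R[i]) : R[i] :=
  rsum D (fun k => complex.Re (f k)) +i* rsum D (fun k => complex.Im (f k)).

End Series.

Section Torus.
Variable R : realType.

Definition expi (t : R) : R[i] := cos t +i* sin t.

Definition cexp (w : R[i]) : R[i] :=
  (expR (complex.Re w))%:C * expi (complex.Im w).

Definition torus (m : nat) : set 'rV[R[i]]_m :=
  [set z | forall i, `|z ord0 i| = 1].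

Definition zpow (m : nat) (z : 'rV[R[i]]_m) (k : 'rV[int]_m) : R[i] :=
  \prod_(i < m) z ord0 i ^ k ord0 i.

Definition zinv (m : nat) (z : 'rV[R[i]]_m) : 'rV[R[i]]_m :=
  map_mx (fun w => w^-1) z.

Definition cint (a b : R) (f : R -> R[i]) : R[i] :=
  (\int[lebesgue_measure]_(t in `[a, b]) complex.Re (f t)) +i*
  (\int[lebesgue_measure]_(t in `[a, b]) complex.Im (f t)).

(* (2 pi)^(-m) int_{[0, 2 pi]^m} u(e^{i t_1}, ..., e^{i t_m}) dt, as an
   iterated integral.  Functions on the torus are represented by functions on
   C^m of which only the values on the torus are used. *)
Fixpoint torus_mean (m : nat) : ('rV[R[i]]_m -> R[i]) -> R[i] :=
  match m with
  | 0%N => fun u => u (const_mx 1)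
  | m'.+1 => fun u =>
      ((2 * pi)^-1)%:C *
      cint 0 (2 * pi) (fun t => torus_mean (fun z : 'rV[R[i]]_m' =>
        u (row_mx (const_mx (expi t) : 'rV[R[i]]_1) z)))
  end.

Definition fourier (m : nat) (u : 'rV[R[i]]_m -> R[i]) (k : 'rV[int]_m)
    : R[i] :=
  torus_mean (fun z => u z * zpow z (- k)).

End Torus.

Record lattice_order (m : nat) := LatticeOrder {
  lo_le :> rel 'rV[int]_m;
  lo_refl : reflexive lo_le;
  lo_anti : antisymmetric lo_le;
  lo_trans : transitive lo_le;
  lo_total : total lo_le;
  lo_add : forall j k l, lo_le j k -> lo_le (j + l) (k + l)
}.

Definition upper_lattice (n : nat) : set 'rV[int]_n.+1 :=
  [set k | 0 <= k ord0 ord_max].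

Inductive half_lattice (n : nat) : Type :=
| Upper
| Cone of lattice_order n.+1.
Arguments Upper {n}.

Definition half_set (n : nat) (H : half_lattice n) : set 'rV[int]_n.+1 :=
  match H with
  | Upper => @upper_lattice n
  | Cone le => [set k | le 0 k]
  end.

Section SemiCardinal.
Variables (R : realType) (n : nat).
Local Notation lattice := 'rV[int]_n.+1.
Local Notation Cd := 'rV[R[i]]_n.+1.
Implicit Types (phi : 'rV[R]_n.+1 -> R) (H : half_lattice n) (z : Cd).

Definition amalgam_norm phi : \bar R :=
  ereal_sup [set (\esum_(k in [set: lattice]) `|phi (x - of_lattice R k)|%:E)%E
            | x in [set x : 'rV[R]_n.+1 | forall i, 0 <= x ord0 i <= 1]].

Definition cardinal_symbol phi z : R[i] :=
  csum [set: lattice] (fun k => (phi (of_lattice R k))%:C * zpow z k).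

Definition omega phi z : R[i] := (cardinal_symbol phi z)^-1.

(* On the torus omega is a positive real number, so that log is [ln]. *)
Definition log_omega phi z : R[i] := (ln (complex.Re (omega phi z)))%:C.

Definition lambda phi : lattice -> R[i] := fourier (log_omega phi).

Definition Lambda_plus phi H z : R[i] :=
  match H with
  | Upper =>
      2^-1 * csum [set k : lattice | k ord0 ord_max = 0]
                  (fun k => lambda phi k * zpow z k)
      + csum [set k : lattice | 0 < k ord0 ord_max]
             (fun k => lambda phi k * zpow z k)
  | Cone le =>
      2^-1 * lambda phi 0
      + csum [set k : lattice | le 0 k /\ k <> 0]
             (fun k => lambda phi k * zpow z k)
  end.

Definition omega_plus phi H z : R[i] := cexp (Lambda_plus phi H z).

Definition gamma phi H : lattice -> R[i] := fourier (omega_plus phi H).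

Definition P_plus H (psi : Cd -> R[i]) z : R[i] :=
  csum (half_set H) (fun k => fourier psi k * zpow z k).

Definition semi_symbol phi H (j : lattice) z : R[i] :=
  omega_plus phi H z *
  P_plus H (fun w => zpow w j * omega_plus phi H (zinv w)) z.

Definition semi_coef phi H (k j : lattice) : R[i] :=
  fourier (semi_symbol phi H j) k.

End SemiCardinal.

(* Main.v *)
(* Write sigma = M (1 - g) with 0 <= g <= q < 1 on the torus, so that
   log omega = - log M + sum_n g^n / n.  Split g = p + r with p a trigonometric
   polynomial and r of small l^1 norm.  The coefficients of p^n are at most a
   constant times (q + eps)^n, and its support grows linearly in n, so any
   weighted norm of p^n is O((q + 2 eps)^n) as long as the weight is
   subexponential, or exponential with a small rate.  For r^n one uses the
   inequality |rs|_w <= K (|r|_w |s|_1 + |r|_1 |s|_w), valid for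
   w = (1 + |k|)^alpha, so that only the l^1 norm of r enters the growth rate.
   Hence log omega has coefficients with the required decay, which survives the
   restriction to half of the lattice and the exponential; this bounds gamma.
   Finally a_{k,j} = sum_m gamma_{k-m} gamma_{j-m}, over the m with k - m, j - m
   and m in H, is estimated by the convolution of the weights.

   Membership in a weighted algebra is expressed by uniform approximability on
   the torus by trigonometric polynomials of bounded weighted norm; this avoids
   infinite convolutions, and Fourier coefficients are recovered by letting the
   approximation error tend to 0. *)

Require Import Defs.
From mathcomp Require Import all_boot all_order all_algebra.
From mathcomp Require Import all_classical all_reals all_analysis.
From mathcomp Require Import complex ring lra zify.
Import Order.TTheory GRing.Theory Num.Theory.
Import numFieldNormedType.Exports.
Local Open Scope classical_set_scope.
Local Open Scope complex_scope.
Local Open Scope ring_scope.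

Set Implicit Arguments.
Unset Strict Implicit.
Unset Printing Implicit Defensive.

(** The obstacle is that [g] is below 1 on the torus while its l^1 norm need not be, so the
    logarithmic series cannot be summed by norm bounds alone; what counts is the growth rate of the
    powers of [g]. With mu the minimum of sigma on the torus and eta = mu / (4 M), one has q = 1 - 4
    eta. Truncation makes [p] at most 1 - 3 eta on the torus, the weight on its growing support
    costs another eta, and the powers of [r] grow at rate eta. The rates add up to 1 - eta, which is
    below 1. Both kinds of decay use one pair of norms, an l^1 norm with weight [v] and a sup norm
    with weight [w]. For algebraic decay [v] is 1 and [w] is (1 + |k|)^alpha: pointwise decay of
    order alpha does not give a finite l^1 norm with the same weight, so the exact exponent has to
    be carried by a sup norm. For exponential decay [v] and [w] are the same exponential. *)

(** * Complex modulus and monomials on the torus *)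

Section Modulus.
Variable R : realType.
Implicit Types (w z : R[i]) (t x : R).

(** The norm of [R[i]] takes values in [R[i]]; as a real number the modulus can be used with real
    weights and real arithmetic. *)
Definition cabs z : R := complex.Re `|z|.

Lemma cabsE z : `|z| = (cabs z)%:C.
Proof. by rewrite /cabs normc_def. Qed.

Lemma cabs_ge0 z : 0 <= cabs z.
Proof. by rewrite /cabs normc_def /= sqrtr_ge0. Qed.

Lemma cabs0 : cabs 0 = 0.
Proof. by apply: complexI; rewrite -cabsE normr0. Qed.

Lemma cabs1 : cabs 1 = 1.
Proof. by apply: complexI; rewrite -cabsE normr1. Qed.

Lemma cabsM w z : cabs (w * z) = cabs w * cabs z.
Proof. by apply: complexI; rewrite rmorphM -!cabsE normrM. Qed.

Lemma cabsX z n : cabs (z ^+ n) = cabs z ^+ n.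
Proof. by apply: complexI; rewrite rmorphXn -!cabsE normrX. Qed.

Lemma cabsN z : cabs (- z) = cabs z.
Proof. by rewrite /cabs normrN. Qed.

Lemma cabsV z : cabs z^-1 = (cabs z)^-1.
Proof. by apply: complexI; rewrite fmorphV -!cabsE normfV. Qed.

Lemma cabsB w z : cabs (w - z) = cabs (z - w).
Proof. by rewrite -cabsN opprB. Qed.

Lemma cabsD w z : cabs (w + z) <= cabs w + cabs z.
Proof. by rewrite -lecR rmorphD -!cabsE ler_normD. Qed.

Lemma cabs_dist w z y : cabs (w - z) <= cabs (w - y) + cabs (y - z).
Proof. by apply: le_trans (cabsD _ _); rewrite addrA subrK. Qed.

Lemma cabs_sum (I : Type) (s : seq I) (P : pred I) (F : I -> R[i]) :
  cabs (\sum_(i <- s | P i) F i) <= \sum_(i <- s | P i) cabs (F i).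
Proof.
elim/big_ind2: _ => //; first by rewrite cabs0.
by move=> a b c d ab cd; rewrite (le_trans (cabsD _ _)) ?lerD.
Qed.

Lemma cabsC x : cabs x%:C = `|x|.
Proof. by rewrite /cabs normc_def /= expr0n addr0 sqrtr_sqr. Qed.

Lemma cabs_Re z : `|complex.Re z| <= cabs z.
Proof. by rewrite -lecR -cabsE normc_ge_Re. Qed.

Lemma cabs_Im z : `|complex.Im z| <= cabs z.
Proof.
rewrite /cabs normc_def /= -(sqrtr_sqr (complex.Im z)) ler_sqrt.
  by rewrite lerDr sqr_ge0.
by rewrite addr_ge0 ?sqr_ge0.
Qed.

Lemma cabs_le z : cabs z <= `|complex.Re z| + `|complex.Im z|.
Proof.
rewrite {1}(complexE z) (le_trans (cabsD _ _))// cabsM !cabsC.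
by rewrite [cabs 'i](_ : _ = 1) ?mul1r// /cabs normc_def /= expr0n add0r
  expr1n sqrtr1.
Qed.

Lemma cabs_eq0 z : cabs z <= 0 -> z = 0.
Proof.
move=> h; apply/eqP; rewrite -normr_eq0 cabsE.
by rewrite (_ : cabs z = 0)//; apply/eqP; rewrite eq_le h cabs_ge0.
Qed.

Lemma ReD z w : complex.Re (z + w) = complex.Re z + complex.Re w.
Proof. by case: z; case: w. Qed.

Lemma ImD z w : complex.Im (z + w) = complex.Im z + complex.Im w.
Proof. by case: z; case: w. Qed.

Lemma ReN z : complex.Re (- z) = - complex.Re z.
Proof. by case: z. Qed.

Lemma ImN z : complex.Im (- z) = - complex.Im z.
Proof. by case: z. Qed.

Lemma ReM z w : complex.Re (z * w) =
  complex.Re z * complex.Re w - complex.Im z * complex.Im w.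
Proof. by case: z; case: w. Qed.

Lemma ImM z w : complex.Im (z * w) =
  complex.Re z * complex.Im w + complex.Im z * complex.Re w.
Proof. by case: z; case: w. Qed.

Lemma Re_sum (I : Type) (s : seq I) (P : pred I) (F : I -> R[i]) :
  complex.Re (\sum_(i <- s | P i) F i) = \sum_(i <- s | P i) complex.Re (F i).
Proof. exact: (big_morph _ ReD). Qed.

Lemma Im_sum (I : Type) (s : seq I) (P : pred I) (F : I -> R[i]) :
  complex.Im (\sum_(i <- s | P i) F i) = \sum_(i <- s | P i) complex.Im (F i).
Proof. exact: (big_morph _ ImD). Qed.

Lemma complex_eqP z w :
  complex.Re z = complex.Re w -> complex.Im z = complex.Im w -> z = w.
Proof. by case: z; case: w => /= ? ? ? ? -> ->. Qed.

Lemma cabs_expi t : cabs (expi t) = 1.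
Proof. by rewrite /cabs normc_def /= cos2Dsin2 sqrtr1. Qed.

Lemma expiD t x : expi (t + x) = expi t * expi x.
Proof. by apply: complex_eqP; rewrite /= ?cosD ?sinD//; ring. Qed.

Lemma expi0 : expi 0 = 1 :> R[i].
Proof. by rewrite /expi cos0 sin0. Qed.

Lemma expiN t : expi (- t) = (expi t)^-1.
Proof.
have e0 : expi t != 0.
  apply/eqP => e; have := cabs_expi t; rewrite e cabs0 => /eqP.
  by rewrite eq_sym oner_eq0.
by apply: (mulIf e0); rewrite mulVf// -expiD addNr expi0.
Qed.

Lemma expiX t (k : int) : expi t ^ k = expi (k%:~R * t).
Proof.
have nat_case n : expi t ^+ n = expi (n%:R * t).
  elim: n => [|n ih]; first by rewrite mul0r expi0.
  by rewrite exprS ih -expiD -natr1 mulrDl mul1r addrC.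
case: k => n; first exact: nat_case.
by rewrite NegzE -exprnN nat_case -expiN mulrNz mulNr.
Qed.

(** The angle is confined to a compact interval so that the torus becomes the image of a compact
    cube in [torus_min]. [acos] gives the angle up to the sign of the imaginary part. *)
Lemma unit_expi z : cabs z = 1 ->
  exists2 t, z = expi t & - pi <= t <= pi.
Proof.
move=> z1; have re1 : -1 <= complex.Re z <= 1.
  by rewrite -ler_norml -z1 cabs_Re.
have /andP[a0 api] : 0 <= acos (complex.Re z) <= pi.
  by rewrite acos_ge0 ?acos_lepi.
have sq : complex.Im z ^+ 2 = 1 - complex.Re z ^+ 2.
  have := z1; rewrite /cabs normc_def /= => /(congr1 (fun x => x ^+ 2)).
  rewrite sqr_sqrtr ?expr1n; last by rewrite addr_ge0 ?sqr_ge0.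
  by move=> <-; rewrite addrC addKr.
have sa : sin (acos (complex.Re z)) = `|complex.Im z|.
  by rewrite sin_acos// -sq sqrtr_sqr.
case: (leP 0 (complex.Im z)) => im0.
  exists (acos (complex.Re z)); last by lra.
  by apply: complex_eqP; rewrite /= ?acosK// sa ger0_norm.
exists (- acos (complex.Re z)); last by lra.
by apply: complex_eqP; rewrite /= ?cosN ?acosK// sinN sa ltr0_norm// opprK.
Qed.

End Modulus.

Section Monomials.
Variables (R : realType) (m : nat).
Implicit Types (z : 'rV[R[i]]_m) (k l : 'rV[int]_m).

Lemma torus_cabs z i : torus z -> cabs (z ord0 i) = 1.
Proof. by move=> zT; rewrite /cabs zT. Qed.

Lemma torus_neq0 z i : torus z -> z ord0 i != 0.
Proof.
by move=> zT; rewrite -normr_eq0 (zT i) oner_eq0.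
Qed.

Lemma torus_zinv z : torus z -> torus (zinv z).
Proof. by move=> zT i; rewrite mxE normfV zT invr1. Qed.

Lemma torus_expi (t : 'rV[R]_m) : torus (map_mx (@expi R) t).
Proof. by move=> i; rewrite mxE cabsE cabs_expi. Qed.

Lemma zpow0 z : zpow z 0 = 1.
Proof. by rewrite /zpow big1// => i _; rewrite mxE expr0z. Qed.

Lemma zpowD z k l : torus z -> zpow z (k + l) = zpow z k * zpow z l.
Proof.
move=> zT; rewrite /zpow -big_split; apply: eq_bigr => i _.
by rewrite mxE expfzDr ?torus_neq0.
Qed.

Lemma zpow_zinv z k : zpow (zinv z) k = zpow z (- k).
Proof. by apply: eq_bigr => i _; rewrite !mxE exprz_inv. Qed.

Lemma cabs_zpow z k : torus z -> cabs (zpow z k) = 1.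
Proof.
move=> zT; rewrite /zpow; apply: (big_ind (fun w => cabs w = 1)).
- exact: cabs1.
- by move=> a b a1 b1; rewrite cabsM a1 b1 mulr1.
move=> i _; case: (k ord0 i) => n; rewrite ?NegzE -?exprnP -?exprnN ?cabsV cabsX
  torus_cabs// expr1n ?invr1//.
Qed.

End Monomials.

(** * Fourier coefficients of uniform limits of trigonometric polynomials *)

Section Continuity.
Variables (R : realType) (T : topologicalType).
Implicit Types (f g : T -> R[i]).

Definition ccontinuous f : Prop :=
  continuous (fun x => complex.Re (f x)) /\
  continuous (fun x => complex.Im (f x)).

Lemma ccontinuous_cst (c : R[i]) : ccontinuous (fun=> c).
Proof. by split => x; exact: cvg_cst. Qed.

Lemma ccontinuousD f g :
  ccontinuous f -> ccontinuous g -> ccontinuous (fun x => f x + g x).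
Proof.
move=> [f1 f2] [g1 g2]; split.
- rewrite (_ : (fun x => _) = (fun x => complex.Re (f x)) \+
    (fun x => complex.Re (g x))); last by apply/funext => x; rewrite ReD.
  by move=> x; apply: continuousD; [exact: f1|exact: g1].
- rewrite (_ : (fun x => _) = (fun x => complex.Im (f x)) \+
    (fun x => complex.Im (g x))); last by apply/funext => x; rewrite ImD.
  by move=> x; apply: continuousD; [exact: f2|exact: g2].
Qed.

Lemma ccontinuousM f g :
  ccontinuous f -> ccontinuous g -> ccontinuous (fun x => f x * g x).
Proof.
move=> [f1 f2] [g1 g2]; split.
- rewrite (_ : (fun x => _) = (fun x => complex.Re (f x) * complex.Re (g x)) \-
    (fun x => complex.Im (f x) * complex.Im (g x))); last first.
    by apply/funext => x; rewrite ReM.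
  move=> x; apply: continuousB; apply: continuousM;
    [exact: f1|exact: g1|exact: f2|exact: g2].
- rewrite (_ : (fun x => _) = (fun x => complex.Re (f x) * complex.Im (g x)) \+
    (fun x => complex.Im (f x) * complex.Re (g x))); last first.
    by apply/funext => x; rewrite ImM.
  move=> x; apply: continuousD; apply: continuousM;
    [exact: f1|exact: g2|exact: f2|exact: g1].
Qed.

Lemma ccontinuous_sum (I : Type) (s : seq I) (P : pred I)
    (F : I -> T -> R[i]) : (forall i, ccontinuous (F i)) ->
  ccontinuous (fun x => \sum_(i <- s | P i) F i x).
Proof.
move=> Fc; elim: s => [|i s ih].
  rewrite (_ : (fun x => _) = (fun=> 0)); first exact: ccontinuous_cst.
  by apply/funext => x; rewrite big_nil.
case: (boolP (P i)) => Pi.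
  rewrite (_ : (fun x => _) = (fun x => F i x + \sum_(j <- s | P j) F j x)).
    exact: ccontinuousD.
  by apply/funext => x; rewrite big_cons Pi.
rewrite (_ : (fun x => _) = (fun x => \sum_(j <- s | P j) F j x))//.
by apply/funext => x; rewrite big_cons (negbTE Pi).
Qed.

Lemma ccontinuous_prod (I : Type) (s : seq I) (F : I -> T -> R[i]) :
  (forall i, ccontinuous (F i)) ->
  ccontinuous (fun x => \prod_(i <- s) F i x).
Proof.
move=> Fc; elim: s => [|i s ih].
  rewrite (_ : (fun x => _) = (fun=> 1)); first exact: ccontinuous_cst.
  by apply/funext => x; rewrite big_nil.
rewrite (_ : (fun x => _) = (fun x => F i x * \prod_(j <- s) F j x)).
  exact: ccontinuousM.
by apply/funext => x; rewrite big_cons.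
Qed.

Lemma ccontinuous_expi (g : T -> R) :
  continuous g -> ccontinuous (fun x => expi (g x)).
Proof.
move=> gc; split => x /=.
- by apply: (continuous_comp (gc x)); exact: continuous_cos.
- by apply: (continuous_comp (gc x)); exact: continuous_sin.
Qed.

Lemma continuous_unif_approx (f : T -> R) :
  (forall e, 0 < e -> exists2 g : T -> R, continuous g &
    forall x, `|f x - g x| <= e) -> continuous f.
Proof.
move=> fP x; apply/cvgrPdist_lt => e e0.
have [g gc fg] := fP (e / 4) (divr_gt0 e0 (ltr0n _ 4)).
have /cvgrPdist_lt/(_ (e / 4) (divr_gt0 e0 (ltr0n _ 4))) := gc x.
apply: filterS => y gxy.
have h1 := fg x; have h2 := fg y.
rewrite ltr_norml; rewrite ltr_norml in gxy.
move: h1 h2 gxy; rewrite !ler_norml => /andP[? ?] /andP[? ?] /andP[? ?].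
by apply/andP; split; lra.
Qed.

Lemma ccontinuous_unif_approx f :
  (forall e, 0 < e -> exists2 g, ccontinuous g &
    forall x, cabs (f x - g x) <= e) -> ccontinuous f.
Proof.
move=> fP; split; apply: continuous_unif_approx => e /fP[g [g1 g2] fg].
- exists (fun x => complex.Re (g x)) => // x.
  by rewrite -ReN -ReD (le_trans (cabs_Re _)).
- exists (fun x => complex.Im (g x)) => // x.
  by rewrite -ImN -ImD (le_trans (cabs_Im _)).
Qed.

End Continuity.

Section CircleMean.
Variable R : realType.
Implicit Types (f g : R -> R[i]) (h : R -> R) (c : R[i]).
Local Notation mu := (@lebesgue_measure R).

Lemma continuous_itv_integrable h a b : continuous h ->
  mu.-integrable `[a, b] (EFin \o h).
Proof.
move=> hc; apply: continuous_compact_integrable; first exact: segment_compact.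
exact: continuous_subspaceT.
Qed.

Lemma Rintegral_derive h (F : R -> R) (a b : R) : a < b -> continuous h ->
  (forall x : R, is_derive x (1 : R) F (h x)) ->
  \int[mu]_(x in `[a, b]) h x = F b - F a.
Proof.
move=> ab hc Fh; have Fc : continuous F.
  move=> x; apply: differentiable_continuous; apply/derivable1_diffP.
  by have [] := Fh x.
rewrite /Rintegral (@continuous_FTC2 _ h F)//.
- exact: continuous_subspaceT.
- split.
  + by move=> x _; have [] := Fh x.
  + by apply: cvg_at_right_filter; exact: Fc.
  + by apply: cvg_at_left_filter; exact: Fc.
- by move=> x _; rewrite derive1E; have [] := Fh x.
Qed.

Lemma cintD a b f g : ccontinuous f -> ccontinuous g ->
  cint a b (fun t => f t + g t) = cint a b f + cint a b g.
Proof.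
move=> [f1 f2] [g1 g2]; apply: complex_eqP => /=.
- rewrite -RintegralD//; try exact: continuous_itv_integrable.
  by apply: eq_Rintegral => t _; rewrite ReD.
- rewrite -RintegralD//; try exact: continuous_itv_integrable.
  by apply: eq_Rintegral => t _; rewrite ImD.
Qed.

Lemma cint_sum a b (I : Type) (s : seq I) (P : pred I) (F : I -> R -> R[i]) :
  (forall i, ccontinuous (F i)) ->
  cint a b (fun t => \sum_(i <- s | P i) F i t) =
  \sum_(i <- s | P i) cint a b (F i).
Proof.
move=> Fc; elim: s => [|i s ih].
  rewrite big_nil (_ : (fun t => _) = (fun=> 0)).
    apply: complex_eqP => /=; rewrite Rintegral_cst ?mul0r//.
  by apply/funext => x; rewrite big_nil.
rewrite big_cons; case: (boolP (P i)) => Pi.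
  rewrite -ih -cintD//; last exact: ccontinuous_sum.
  by congr cint; apply/funext => x; rewrite big_cons Pi.
by rewrite -ih; congr cint; apply/funext => x; rewrite big_cons (negbTE Pi).
Qed.

(** The factor 2 comes from estimating real and imaginary parts separately; it only affects the
    constant in [torus_mean_approx]. *)
Lemma cint_bound f a b e : a <= b -> ccontinuous f ->
  (forall t, cabs (f t) <= e) -> cabs (cint a b f) <= 2 * (e * (b - a)).
Proof.
move=> ab [f1 f2] fe.
have bound h : continuous h -> (forall t, `|h t| <= e) ->
    `|\int[mu]_(t in `[a, b]) h t| <= e * (b - a).
  move=> hc he; apply: le_trans (le_normr_Rintegral _ _) _ => //.
    exact: continuous_itv_integrable.
  have -> : e * (b - a) = \int[mu]_(t in `[a, b]) e.
    rewrite Rintegral_cst//= lebesgue_measure_itv/= lte_fin.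
    move: ab; rewrite le_eqVlt => /predU1P[->|ab].
      by rewrite ltxx subrr mulr0.
    by rewrite ab.
  apply: le_Rintegral => //; apply: continuous_itv_integrable.
    by move=> x; apply: continuous_comp; [exact: hc|exact: norm_continuous].
  exact: cst_continuous.
apply: le_trans (cabs_le _) _ => /=; rewrite mulr_natl mulr2n.
apply: lerD; apply: bound => // t.
- by rewrite (le_trans (cabs_Re _)).
- by rewrite (le_trans (cabs_Im _)).
Qed.

Lemma ccontinuous_expiX c (n : int) : ccontinuous (fun t => c * expi t ^ n).
Proof.
apply: ccontinuousM; first exact: ccontinuous_cst.
rewrite (_ : (fun x => _) = fun x : R => expi (n%:~R * x)); last first.
  by apply/funext => t; rewrite expiX.
by apply: ccontinuous_expi; exact: mulrl_continuous.
Qed.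

Lemma int_multiple_2pi (n : int) :
  sin (n%:~R * (2 * pi)) = 0 :> R /\ cos (n%:~R * (2 * pi)) = 1 :> R.
Proof.
have : expi (n%:~R * (2 * pi)) = 1 :> R[i].
  rewrite -expiX (_ : expi _ = 1) ?exp1rz//.
  by rewrite /expi mulr_natl cos2pi sin2pi.
by case => -> ->.
Qed.

(** Orthogonality of characters. For nonzero [n] an explicit antiderivative of each part takes the
    same value at 0 and 2 pi. *)
Lemma cint_expi c (n : int) :
  ((2 * pi)^-1)%:C * cint 0 (2 * pi) (fun t => c * expi t ^ n) =
  if n == 0 then c else 0.
Proof.
have pi0 : 0 < 2 * pi :> R by rewrite mulr_gt0// pi_gt0.
have [->|n0] := eqVneq n 0.
  rewrite (_ : (fun t => _) = (fun=> c)); last first.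
    by apply/funext => t; rewrite expr0z mulr1.
  have -> : cint 0 (2 * pi) (fun=> c) = (2 * pi)%:C * c.
    have m2pi : fine (mu `[0, 2 * pi]) = 2 * pi.
      by rewrite lebesgue_measure_itv/= lte_fin pi0 /= oppr0 addr0.
    apply: complex_eqP; rewrite ?ReM ?ImM /= Rintegral_cst//= m2pi;
      by rewrite mul0r ?addr0 ?subr0 mulrC.
  by rewrite mulrA -rmorphM mulVf ?gt_eqF// mul1r.
have [fc1 fc2] := ccontinuous_expiX c n.
have [sn cn] := int_multiple_2pi n.
have nz : n%:~R != 0 :> R by rewrite intr_eq0.
have -> : cint 0 (2 * pi) (fun t => c * expi t ^ n) = 0; last by rewrite mulr0.
pose u := complex.Re c; pose v := complex.Im c.
have dS (x : R) : is_derive x (1 : R) (fun t : R => sin (n%:~R * t))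
    (n%:~R * cos (n%:~R * x)).
  by apply: is_derive_eq; rewrite /GRing.scale /= mulr1 mulrC.
have dC (x : R) : is_derive x (1 : R) (fun t : R => cos (n%:~R * t))
    (- (n%:~R * sin (n%:~R * x))).
  by apply: is_derive_eq; rewrite /GRing.scale /= mulr1 mulrC mulrN.
apply: complex_eqP => /=.
- have dF (x : R) : is_derive x (1 : R)
      (fun t : R => n%:~R^-1 * (u * sin (n%:~R * t) + v * cos (n%:~R * t)))
      (complex.Re (c * expi x ^ n)).
    apply: is_derive_eq.
    by rewrite expiX ReM /= /GRing.scale /= -/u -/v; field.
  rewrite (Rintegral_derive pi0 fc1 dF) !mulr0 sin0 cos0 sn cn; ring.
- have dF (x : R) : is_derive x (1 : R)
      (fun t : R => n%:~R^-1 * (v * sin (n%:~R * t) - u * cos (n%:~R * t)))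
      (complex.Im (c * expi x ^ n)).
    apply: is_derive_eq.
    by rewrite expiX ImM /= /GRing.scale /= -/u -/v; field.
  rewrite (Rintegral_derive pi0 fc2 dF) !mulr0 sin0 cos0 sn cn; ring.
Qed.

End CircleMean.

Section TrigPoly.
Variables (R : realType) (m : nat).
Local Notation lattice := 'rV[int]_m.
Local Notation Cd := 'rV[R[i]]_m.

(* A trigonometric polynomial as a formal sum of monomials; the same exponent
   may occur several times. *)
Definition tpoly := seq (lattice * R[i]).
Implicit Types (p q : tpoly) (z : Cd) (k l : lattice) (u v : Cd -> R[i]).

Definition teval p z : R[i] := \sum_(x <- p) x.2 * zpow z x.1.

Definition tcoef p k : R[i] := \sum_(x <- p | x.1 == k) x.2.

Definition tmul p q : tpoly := [seq (x.1 + y.1, x.2 * y.2) | x <- p, y <- q].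

Definition tshift k p : tpoly := [seq (x.1 + k, x.2) | x <- p].

Definition tscale (c : R[i]) p : tpoly := [seq (x.1, c * x.2) | x <- p].

Definition unif_dist_le (e : R) u v : Prop :=
  forall z, torus z -> cabs (u z - v z) <= e.

Definition unif_approx u : Prop :=
  forall e, 0 < e -> exists p, unif_dist_le e u (teval p).

Lemma teval_cat p q z : teval (p ++ q) z = teval p z + teval q z.
Proof. by rewrite /teval big_cat. Qed.

Lemma teval_scale c p z : teval (tscale c p) z = c * teval p z.
Proof.
by rewrite /teval big_map mulr_sumr; apply: eq_bigr => x _; rewrite mulrA.
Qed.

Lemma teval_mul p q z : torus z -> teval (tmul p q) z = teval p z * teval q z.
Proof.
move=> zT; rewrite /teval /tmul big_allpairs_dep mulr_suml.
apply: eq_bigr => x _; rewrite mulr_sumr; apply: eq_bigr => y _ /=.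
by rewrite zpowD//; ring.
Qed.

Lemma teval_shift k p z :
  torus z -> teval (tshift k p) z = teval p z * zpow z k.
Proof.
move=> zT; rewrite /teval big_map mulr_suml.
by apply: eq_bigr => x _; rewrite zpowD// mulrA.
Qed.

Lemma tcoef_shift k p l : tcoef (tshift k p) l = tcoef p (l - k).
Proof.
rewrite /tcoef big_map; apply: eq_bigl => x /=.
by rewrite -subr_eq0 -[RHS]subr_eq0 opprB addrA.
Qed.

Lemma tcoef_mul p q k :
  tcoef (tmul p q) k = \sum_(x <- q) tcoef p (k - x.1) * x.2.
Proof.
rewrite /tcoef /tmul big_mkcond big_allpairs_dep /= exchange_big /=.
apply: eq_bigr => y _; rewrite mulr_suml [RHS]big_mkcond.
by apply: eq_bigr => x _; rewrite -(inj_eq (addIr (- y.1))) addrK.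
Qed.

Lemma unif_approx_teval p : unif_approx (teval p).
Proof.
by move=> e e0; exists p => z zT; rewrite subrr cabs0 ltW.
Qed.

Lemma ccontinuous_teval p :
  ccontinuous (fun t : 'rV[R]_m => teval p (map_mx (@expi R) t)).
Proof.
apply: ccontinuous_sum => x; apply: ccontinuousM.
  exact: ccontinuous_cst.
apply: ccontinuous_prod => i.
rewrite (_ : (fun t => _) =
  fun t : 'rV[R]_m => expi ((x.1 ord0 i)%:~R * t ord0 i)); last first.
  by apply/funext => t; rewrite mxE expiX.
apply: ccontinuous_expi => t.
apply: (@continuous_comp _ _ _ (fun t : 'rV[R]_m => t ord0 i)
   (fun s => (x.1 ord0 i)%:~R * s)); first exact: coord_continuous.
exact: mulrl_continuous.
Qed.

End TrigPoly.

Section TorusMean.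
Variable R : realType.

Definition ktail m (k : 'rV[int]_m.+1) : 'rV[int]_m :=
  \row_i k ord0 (lift ord0 i).

Lemma zpow_row_mx m (w : R[i]) (z : 'rV[R[i]]_m) (k : 'rV[int]_m.+1) :
  zpow (row_mx (const_mx w : 'rV[R[i]]_1) z) k =
  w ^ k ord0 ord0 * zpow z (ktail k).
Proof.
rewrite /zpow big_ord_recl; congr (_ * _).
  by rewrite mxE; case: splitP => // j _; rewrite mxE.
apply: eq_bigr => i _; rewrite !mxE; case: splitP => j ij.
  by have := ltn_ord j; rewrite -ij.
have -> // : i = j.
by apply/val_inj; have := ij; rewrite /= /bump /= !add1n => -[].
Qed.

Lemma torus_row_mx m (t : R) (z : 'rV[R[i]]_m) : torus z ->
  torus (row_mx (const_mx (expi t) : 'rV[R[i]]_1) z : 'rV[R[i]]_m.+1).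
Proof.
move=> zT i; rewrite mxE; case: splitP => j _; last exact: zT.
by rewrite mxE cabsE cabs_expi.
Qed.

Lemma ktail_eq0 m (k : 'rV[int]_m.+1) :
  (k == 0) = (ktail k == 0) && (k ord0 ord0 == 0).
Proof.
apply/eqP/andP => [->|[/eqP k0 /eqP k00]].
  by rewrite !mxE; split=> //; apply/eqP/rowP => i; rewrite !mxE.
apply/rowP => i; rewrite mxE; case: (unliftP ord0 i) => [j|] -> //.
by have := congr1 (fun l : 'rV[int]_m => l ord0 j) k0; rewrite !mxE.
Qed.

Definition tslice m (t : R) (p : tpoly R m.+1) : tpoly R m :=
  [seq (ktail x.1, x.2 * expi t ^ x.1 ord0 ord0) | x <- p].

Lemma teval_slice m t (p : tpoly R m.+1) z :
  teval (tslice t p) z = teval p (row_mx (const_mx (expi t) : 'rV[R[i]]_1) z).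
Proof.
by rewrite /teval big_map; apply: eq_bigr => x _ /=; rewrite zpow_row_mx mulrA.
Qed.

(* [torus_mean] is an iterated integral, hence junk unless every slice is
   integrable; uniform approximability passes to the slices and makes the inner
   means continuous. *)
Lemma torus_mean_approx m : exists2 K : R, 0 < K &
  forall u : 'rV[R[i]]_m -> R[i], unif_approx u -> forall p e,
    unif_dist_le e u (teval p) -> cabs (torus_mean u - tcoef p 0) <= K * e.
Proof.
elim: m => [|m [K K0 ih]].
  exists 1 => // u _ p e /(_ (const_mx 1)); rewrite mul1r /=.
  have -> : tcoef p 0 = teval p (const_mx 1).
    rewrite /tcoef /teval big_mkcond; apply: eq_bigr => x _.
    by rewrite thinmx0 eqxx /zpow big_ord0 mulr1.
  by apply => -[].
(* Each integration costs the factor 2 of [cint_bound], while the length 2 pi cancels against the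
   normalisation. *)
exists (2 * K); first by rewrite mulr_gt0.
move=> u uP p e up.
pose f t := torus_mean (fun z : 'rV[R[i]]_m =>
  u (row_mx (const_mx (expi t) : 'rV[R[i]]_1) z)).
pose h (q : tpoly R m.+1) t := tcoef (tslice t q) 0.
have slice q d t : unif_dist_le d u (teval q) ->
    cabs (f t - h q t) <= K * d.
  move=> uq; apply: ih.
    move=> d' d'0; have [r ur] := uP d' d'0; exists (tslice t r) => z zT.
    by rewrite teval_slice; exact/ur/torus_row_mx.
  by move=> z zT; rewrite teval_slice; exact/uq/torus_row_mx.
have hE q t : h q t =
    \sum_(x <- q | ktail x.1 == 0) x.2 * expi t ^ x.1 ord0 ord0.
  by rewrite /h /tcoef big_map.
have hc q : ccontinuous (h q).
  rewrite (_ : h q = fun t =>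
    \sum_(x <- q | ktail x.1 == 0) x.2 * expi t ^ x.1 ord0 ord0).
    by apply: ccontinuous_sum => x; exact: ccontinuous_expiX.
  by apply/funext => t; rewrite hE.
have fc : ccontinuous f.
  apply: ccontinuous_unif_approx => d d0.
  have [q uq] := uP (d / K) (divr_gt0 d0 K0).
  exists (h q) => // t; rewrite (le_trans (slice _ _ t uq))//.
  by rewrite mulrC divfK// gt_eqF.
have pi0 : 0 < 2 * pi :> R by rewrite mulr_gt0// pi_gt0.
have int_h : ((2 * pi)^-1)%:C * cint 0 (2 * pi) (h p) = tcoef p 0.
  rewrite (_ : h p = fun t =>
    \sum_(x <- p | ktail x.1 == 0) x.2 * expi t ^ x.1 ord0 ord0); last first.
    by apply/funext => t; rewrite hE.
  rewrite cint_sum; last by move=> x; exact: ccontinuous_expiX.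
  rewrite mulr_sumr /tcoef; under eq_bigr do rewrite cint_expi.
  rewrite -big_mkcondr; apply: eq_bigl => x.
  by rewrite ktail_eq0.
have fhc : ccontinuous (fun t => f t + -1 * h p t).
  by apply: ccontinuousD => //; apply: ccontinuousM => //; exact: ccontinuous_cst.
have int_f : cint 0 (2 * pi) f =
    cint 0 (2 * pi) (fun t => f t + -1 * h p t) + cint 0 (2 * pi) (h p).
  rewrite -cintD//; congr cint; apply/funext => t; ring.
rewrite [torus_mean u](_ : _ = ((2 * pi)^-1)%:C * cint 0 (2 * pi) f)//.
rewrite int_f mulrDr int_h addrK cabsM cabsC ger0_norm; last first.
  by rewrite invr_ge0 ltW.
rewrite mulrC ler_pdivrMr//.
have := @cint_bound _ (fun t => f t + -1 * h p t) 0 (2 * pi) (K * e)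
  (ltW pi0) fhc _.
rewrite subr0 !mulrA; apply => t.
by rewrite mulN1r slice.
Qed.

End TorusMean.

(** The form in which approximation errors are sent to 0; [c] gathers the factors that do not depend
    on the error. *)
Lemma le_eps (R : realFieldType) (x y c : R) :
  0 <= c -> (forall e, 0 < e -> x <= y + c * e) -> x <= y.
Proof.
move=> c0 h; apply/ler_addgt0Pr => e e0.
have c1 : 0 < c + 1 by lra.
apply: le_trans (h (e / (c + 1)) (divr_gt0 e0 c1)) _.
rewrite lerD2l mulrA ler_pdivrMr//; nra.
Qed.

(** * Unordered sums and their finite parts *)

Section FiniteSums.
Variables (R : realDomainType) (T : eqType).

Lemma sum_fibre_le (I : eqType) (g : I -> T) (s : seq T) (p : seq I)
    (F : I -> R) :
  uniq s -> (forall x, 0 <= F x) ->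
  \sum_(k <- s) \sum_(x <- p | g x == k) F x <= \sum_(x <- p) F x.
Proof.
move=> us F0; rewrite (exchange_big_dep predT)//=; apply: ler_sum => x _.
rewrite big_const_seq iter_addr_0 (@eq_count _ _ (pred1 (g x))); last first.
  by move=> k /=; rewrite eq_sym.
by rewrite count_uniq_mem//; case: (_ \in _); rewrite ?mulr1n ?mulr0n.
Qed.

End FiniteSums.

Lemma sum_fibre_undup (V : nmodType) (I T : eqType) (g : I -> T) (p : seq I)
    (F : I -> V) :
  \sum_(k <- undup [seq g x | x <- p]) \sum_(x <- p | g x == k) F x =
  \sum_(x <- p) F x.
Proof.
rewrite (exchange_big_dep predT)//= big_seq [RHS]big_seq.
apply: eq_bigr => x xp; rewrite -big_filter.
rewrite (_ : [seq k <- _ | g x == k] =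
    [seq k <- undup [seq g y | y <- p] | pred1 (g x) k]); last first.
  by apply: eq_filter => k /=; rewrite eq_sym.
by rewrite filter_pred1_uniq ?undup_uniq ?mem_undup ?map_f// big_seq1.
Qed.

Section Summation.
Variables (R : realType) (T : choiceType).
Implicit Types (D : set T) (s : seq T) (e B : R).

(** Summability of a nonnegative family expressed by its finite partial sums, so that extended reals
    enter only in [rsum_approx] and the lemma before it. *)
Definition sums_le D (F : T -> R) B : Prop :=
  forall s, uniq s -> (forall k, k \in s -> D k) -> \sum_(k <- s) F k <= B.

(** Take a finite sum within [e] of the supremum of all finite sums: a further disjoint finite set
    can add at most [e]. *)
Lemma sums_le_tail D (F : T -> R) B e :
  sums_le D F B -> 0 < e ->
  exists s0, [/\ uniq s0, (forall k, k \in s0 -> D k) &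
    sums_le (D `\` [set` s0]) F e].
Proof.
move=> FB e0.
pose A := [set x | exists s, [/\ uniq s, (forall k, k \in s -> D k) &
  x = \sum_(k <- s) F k]].
have supA : has_sup A.
  split; first by exists 0, [::]; split => //; rewrite big_nil.
  by exists B => _ [s [us sD ->]]; exact: FB.
have [x [s0 [us0 s0D ->]] xe] := sup_adherent e0 supA.
exists s0; split => // s us sD.
have : \sum_(k <- s0 ++ s) F k <= sup A.
  apply: sup_upper_bound => //; exists (s0 ++ s); split => //.
    rewrite cat_uniq us0 us andbT /=; apply/hasPn => k /sD[_ /= ks0].
    by apply/negP.
  by move=> k; rewrite mem_cat => /orP[/s0D|/sD[]].
rewrite big_cat /=; lra.
Qed.

Lemma sums_le_esum D (g : T -> R) s0 e :
  (forall k, 0 <= g k) -> uniq s0 -> (forall k, k \in s0 -> D k) ->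
  sums_le (D `\` [set` s0]) g e ->
  exists2 x, (\esum_(k in D) (g k)%:E)%E = x%:E &
    \sum_(k <- s0) g k <= x <= \sum_(k <- s0) g k + e.
Proof.
move=> g0 us0 s0D ge.
have lb : ((\sum_(k <- s0) g k)%:E <= \esum_(k in D) (g k)%:E)%E.
  apply: ereal_sup_ubound; exists [set` s0].
    by split; [exact: finite_seq|move=> k; exact: s0D].
  by rewrite -fsbig_seq// sumEFin.
have ub : (\esum_(k in D) (g k)%:E <= (\sum_(k <- s0) g k + e)%:E)%E.
  apply: ge_ereal_sup => _ [A [finA AD] <-].
  rewrite fsbig_finite// sumEFin lee_fin.
  rewrite (bigID (fun k => k \in s0))/= lerD//.
    rewrite -big_filter big_seq; set t := [seq _ <- _ | _].
    rewrite -big_seq (perm_big [seq k <- s0 | k \in A]); last first.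
      apply: uniq_perm; rewrite ?filter_uniq ?fset_uniq// => k.
      by rewrite !mem_filter in_fset_set// andbC.
    by rewrite big_filter [leRHS](bigID (fun k => k \in A))/= lerDl sumr_ge0.
  rewrite -big_filter; apply: ge; first by rewrite filter_uniq ?fset_uniq.
  move=> k; rewrite mem_filter in_fset_set// => /andP[ks0]; rewrite inE => Ak.
  by split; [exact: AD|apply/negP].
move: lb ub; case: (esum _ _) => [x||]//; rewrite !lee_fin => lb ub.
by exists x => //; rewrite lb.
Qed.

(** The sums of the positive and of the negative part each exceed their partial sums by an amount in
    [0, e], so the difference is off by at most [e], without a factor 2. *)
Lemma rsum_approx D (f : T -> R) s0 e :
  uniq s0 -> (forall k, k \in s0 -> D k) ->
  sums_le (D `\` [set` s0]) (fun k => `|f k|) e ->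
  `|rsum D f - \sum_(k <- s0) f k| <= e.
Proof.
move=> us0 s0D fe; rewrite /rsum.
have part (g : T -> R) : (forall k, 0 <= g k <= `|f k|) ->
    exists2 x, (\esum_(k in D) (g k)%:E)%E = x%:E &
      \sum_(k <- s0) g k <= x <= \sum_(k <- s0) g k + e.
  move=> gf; apply: sums_le_esum => //; first by move=> k; have /andP[] := gf k.
  move=> s us sD; apply: le_trans (fe s us sD).
  by apply: ler_sum => k _; have /andP[] := gf k.
have [k|x xE xs] := part (fun k => Num.max (f k) 0).
  rewrite le_max lexx orbT ge_max normr_ge0 ler_norm//.
have [k|y yE ys] := part (fun k => Num.max (- f k) 0).
  rewrite le_max lexx orbT ge_max normr_ge0 -normrN ler_norm//.
have -> : (\esum_(k in D) ((EFin \o f)^\+ k))%E = x%:E.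
  rewrite -xE; apply: eq_esum => k _.
  by rewrite funeposE /= EFin_max.
have -> : (\esum_(k in D) ((EFin \o f)^\- k))%E = y%:E.
  rewrite -yE; apply: eq_esum => k _.
  by rewrite funenegE /= EFin_max EFinN.
have fE : \sum_(k <- s0) f k = \sum_(k <- s0) Num.max (f k) 0 -
    \sum_(k <- s0) Num.max (- f k) 0.
  rewrite -sumrB; apply: eq_bigr => k _; case: (leP (f k) 0) => fk.
    by rewrite max_l ?oppr_ge0// sub0r opprK.
  by rewrite max_r ?subr0// oppr_le0 ltW.
by rewrite -EFinB /= fE ler_norml; lra.
Qed.

Lemma csum_approx D (f : T -> R[i]) s0 e :
  uniq s0 -> (forall k, k \in s0 -> D k) ->
  sums_le (D `\` [set` s0]) (fun k => cabs (f k)) e ->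
  cabs (csum D f - \sum_(k <- s0) f k) <= 2 * e.
Proof.
move=> us0 s0D fe; apply: le_trans (cabs_le _) _.
rewrite ReD ImD ReN ImN Re_sum Im_sum /= mulr_natl mulr2n.
apply: lerD; apply: rsum_approx => // s us sD; apply: le_trans (fe s us sD);
  apply: ler_sum => k _; [exact: cabs_Re|exact: cabs_Im].
Qed.

End Summation.

Section Fourier.
Variables (R : realType) (m : nat).
Local Notation Cd := 'rV[R[i]]_m.
Implicit Types (p q : tpoly R m) (u : Cd -> R[i]).

(** The constant is uniform in [k] because multiplication by a monomial shifts coefficients and
    preserves the modulus on the torus, which reduces everything to the mean. *)
Lemma fourier_approx : exists2 K : R, 0 < K &
  forall u, unif_approx u -> forall p e, unif_dist_le e u (teval p) ->
  forall k, cabs (fourier u k - tcoef p k) <= K * e.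
Proof.
have [K K0 KP] := torus_mean_approx R m; exists K => // u uP p e up k.
have shift q d : unif_dist_le d u (teval q) ->
    unif_dist_le d (fun z => u z * zpow z (- k)) (teval (tshift (- k) q)).
  move=> uq z zT; rewrite teval_shift// -mulrBl cabsM cabs_zpow// mulr1.
  exact: uq.
have := KP (fun z => u z * zpow z (- k)) _ _ _ (shift p e up).
rewrite tcoef_shift sub0r opprK; apply.
by move=> d /uP[q uq]; exists (tshift (- k) q); exact: shift.
Qed.

(** [fourier_approx] is applied twice to [teval p]: with error 0 against [p] itself, and with error
    [Q] against the empty polynomial. *)
Lemma tcoef_bound : exists2 K : R, 0 < K & forall p Q,
  (forall z, torus z -> cabs (teval p z) <= Q) ->
  forall k, cabs (tcoef p k) <= K * Q.
Proof.
have [K K0 KP] := fourier_approx; exists K => // p Q pQ k.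
have fp : fourier (teval p) k = tcoef p k.
  apply/eqP; rewrite -subr_eq0; apply/eqP/cabs_eq0.
  rewrite -(mulr0 K); apply: KP; first exact: unif_approx_teval.
  by move=> z _; rewrite subrr cabs0.
have := KP _ (unif_approx_teval p) [::] Q _ k.
rewrite fp /tcoef big_nil subr0; apply => z zT.
by rewrite /teval big_nil subr0 pQ.
Qed.

End Fourier.

(** * Weighted norms of Fourier coefficients *)

Section WeightedApproximation.
Variables (R : realType) (m : nat).
Local Notation lattice := 'rV[int]_m.
Local Notation Cd := 'rV[R[i]]_m.

(* [v] weighs an l^1 norm and [w] a sup norm of the Fourier coefficients. *)
Record weights (v w : lattice -> R) (K : R) : Prop := Weights {
  weights_K : 1 <= K;
  weights_v0 : v 0 = 1;
  weights_w0 : w 0 = 1;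
  weights_v1 : forall k, 1 <= v k;
  weights_w_ge0 : forall k, 0 <= w k;
  weights_vD : forall k l, v (k + l) <= v k * v l;
  weights_wD : forall k l, w (k + l) <= K * (w k * v l + v k * w l)
}.

Variables (v w : lattice -> R) (K : R).
Hypothesis vw : weights v w K.

Implicit Types (p q : tpoly R m) (u : Cd -> R[i]) (S : set lattice)
  (a b c e : R) (k l : lattice).

(** Absolute values are summed over the formal terms, before equal exponents are merged. This
    dominates the norms of the true coefficients and makes sums and products of formal polynomials
    easy to bound. *)
Record tnorm_le S a b p : Prop := TnormLe {
  tnorm_supp : forall x, x \in p -> S x.1;
  tnorm_l1 : \sum_(x <- p) cabs x.2 * v x.1 <= a;
  tnorm_sup : forall k, (\sum_(x <- p | x.1 == k) cabs x.2) * w k <= b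
}.

(** The bounds [a] and [b] do not depend on the error, so this describes a closed ball; they are
    explicit because growth rates of powers have to be tracked. *)
Definition approximable S a b u : Prop :=
  forall e, 0 < e -> exists2 p, tnorm_le S a b p & unif_dist_le e u (teval p).

Let v_ge0 k : 0 <= v k.
Proof. exact: le_trans ler01 (weights_v1 vw k). Qed.

Let w_ge0 k : 0 <= w k.
Proof. exact: weights_w_ge0 vw k. Qed.

Let K_ge0 : 0 <= K.
Proof. exact: le_trans ler01 (weights_K vw). Qed.

Lemma tnorm_a_ge0 S a b p : tnorm_le S a b p -> 0 <= a.
Proof.
move=> [_ pa _]; apply: le_trans pa; apply: sumr_ge0 => x _.
by rewrite mulr_ge0 ?cabs_ge0.
Qed.

Lemma tnorm_b_ge0 S a b p : tnorm_le S a b p -> 0 <= b.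
Proof.
move=> [_ _ /(_ 0)]; apply: le_trans.
by rewrite mulr_ge0// sumr_ge0// => x _; exact: cabs_ge0.
Qed.

Lemma tnorm_le_trans S a b a' b' p :
  tnorm_le S a b p -> a <= a' -> b <= b' -> tnorm_le S a' b' p.
Proof.
move=> [pS pa pb] aa bb; split => //; first exact: le_trans aa.
by move=> k; exact: le_trans bb.
Qed.

Lemma tnorm_nil S : tnorm_le S 0 0 [::].
Proof. by split => [//||k]; rewrite big_nil ?mul0r. Qed.

Lemma tnorm_one S : S 0 -> tnorm_le S 1 1 [:: (0, 1)].
Proof.
move=> S0; split => [x||k].
- by rewrite inE => /eqP->.
- by rewrite big_seq1 /= cabs1 (weights_v0 vw) mulr1.
- rewrite big_cons big_nil /=; case: eqP => [<-|_].
    by rewrite cabs1 (weights_w0 vw) addr0 mulr1.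
  by rewrite mul0r.
Qed.

Lemma tnorm_cat S a b a' b' p q :
  tnorm_le S a b p -> tnorm_le S a' b' q -> tnorm_le S (a + a') (b + b') (p ++ q).
Proof.
move=> [pS pa pb] [qS qa qb]; split => [x||k].
- by rewrite mem_cat => /orP[/pS|/qS].
- by rewrite big_cat lerD.
- by rewrite big_cat mulrDl lerD.
Qed.

Lemma tnorm_scale S a b c z p : cabs z <= c ->
  tnorm_le S a b p -> tnorm_le S (c * a) (c * b) (tscale z p).
Proof.
move=> zc pn; have a0 := tnorm_a_ge0 pn; have b0 := tnorm_b_ge0 pn.
case: pn => pS pa pb; split => [x||k].
- by move=> /mapP[y yp ->]; exact: (pS y).
- rewrite big_map; under eq_bigr do rewrite /= cabsM -mulrA.
  rewrite -mulr_sumr ler_pM ?cabs_ge0// sumr_ge0// => x _.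
  by rewrite mulr_ge0 ?cabs_ge0.
- rewrite big_map; under eq_bigr do rewrite /= cabsM.
  rewrite -mulr_sumr -mulrA ler_pM ?cabs_ge0// mulr_ge0//.
  by rewrite sumr_ge0// => x _; exact: cabs_ge0.
Qed.

Lemma tnorm_mul S a b a' b' p q :
  (forall k l, S k -> S l -> S (k + l)) ->
  tnorm_le S a b p -> tnorm_le S a' b' q ->
  tnorm_le S (a * a') (K * (b * a' + a * b')) (tmul p q).
Proof.
move=> SD pn qn; have a0 := tnorm_a_ge0 pn; have b0 := tnorm_b_ge0 pn.
have a'0 := tnorm_a_ge0 qn; have b'0 := tnorm_b_ge0 qn.
case: pn qn => pS pa pb [qS qa qb]; split => [x||k].
- move=> /allpairsP[[y z]/= [yp zq ->]] /=.
  by apply: SD; [exact: (pS y)|exact: (qS z)].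
- rewrite big_allpairs_dep /=.
  apply: le_trans (ler_pM _ _ pa qa); last 2 first.
    by rewrite sumr_ge0// => x _; rewrite mulr_ge0 ?cabs_ge0.
    by rewrite sumr_ge0// => x _; rewrite mulr_ge0 ?cabs_ge0.
  rewrite mulr_suml; apply: ler_sum => x _; rewrite mulr_sumr.
  apply: ler_sum => y _; rewrite cabsM mulrACA.
  by rewrite ler_wpM2l ?mulr_ge0 ?cabs_ge0 ?(weights_vD vw).
(* [A] and [B] come from the two terms of [weights_wD]. In [A], a fixed [y] confines [x] to the
   single fibre k - y.1, where the sup bound of [p] applies; the sum over [y] is then the l^1 norm
   of [q]. [B] is symmetric. *)
- pose A := \sum_(x <- p) \sum_(y <- q | x.1 + y.1 == k)
    (cabs x.2 * w x.1) * (cabs y.2 * v y.1).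
  pose B := \sum_(x <- p) \sum_(y <- q | x.1 + y.1 == k)
    (cabs x.2 * v x.1) * (cabs y.2 * w y.1).
  have AE : A <= b * a'.
    rewrite /A (exchange_big_dep predT)//=.
    apply: le_trans (ler_wpM2l b0 qa); rewrite mulr_sumr; apply: ler_sum => y _.
    rewrite -mulr_suml ler_wpM2r ?mulr_ge0 ?cabs_ge0//.
    apply: le_trans (pb (k - y.1)); rewrite mulr_suml.
    rewrite (eq_bigl (fun x => x.1 == k - y.1)); last first.
      by move=> x; rewrite -(inj_eq (addIr (- y.1))) addrK.
    by apply: ler_sum => x /eqP->.
  have BE : B <= a * b'.
    rewrite /B; apply: le_trans (ler_wpM2r b'0 pa).
    rewrite mulr_suml; apply: ler_sum => x _.
    rewrite -mulr_sumr ler_wpM2l ?mulr_ge0 ?cabs_ge0//.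
    apply: le_trans (qb (k - x.1)); rewrite mulr_suml.
    rewrite (eq_bigl (fun y => y.1 == k - x.1)); last first.
      by move=> y; rewrite -(inj_eq (addrI (- x.1))) addrA addNr add0r addrC.
    by apply: ler_sum => y /eqP->.
  apply: le_trans (_ : K * (A + B) <= _); last by rewrite ler_wpM2l// lerD.
  rewrite big_mkcond big_allpairs_dep /= mulr_suml /A /B -big_split mulr_sumr.
  apply: ler_sum => x _; rewrite /= -big_mkcond mulr_suml -big_split mulr_sumr.
  apply: ler_sum => y /eqP <-; rewrite cabsM /=.
  have := weights_wD vw x.1 y.1.
  have := mulr_ge0 (cabs_ge0 x.2) (cabs_ge0 y.2); nra.
Qed.

Lemma tnorm_teval S a b p z : tnorm_le S a b p -> torus z ->
  cabs (teval p z) <= a.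
Proof.
move=> [_ pa _] zT; apply: le_trans pa; apply: le_trans (cabs_sum _ _ _) _.
apply: ler_sum => x _; rewrite cabsM cabs_zpow// ler_wpM2l ?cabs_ge0//.
exact: weights_v1 vw _.
Qed.

Lemma approximable_unif S a b u : approximable S a b u -> unif_approx u.
Proof. by move=> uP e /uP[p _ up]; exists p. Qed.

Lemma approximable_ge0 S a b u : approximable S a b u -> 0 <= a /\ 0 <= b.
Proof.
move=> /(_ 1 ltr01)[p pn _]; split; [exact: tnorm_a_ge0 pn|exact: tnorm_b_ge0 pn].
Qed.

Lemma approximable_sup S a b u z : approximable S a b u -> torus z ->
  cabs (u z) <= a.
Proof.
move=> uP zT; apply: (@le_eps _ _ _ 1) => // e e0; rewrite mul1r.
have [p pn up] := uP e e0; rewrite -(subrK (teval p z) (u z)).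
apply: le_trans (cabsD _ _) _; rewrite addrC lerD ?up//.
exact: tnorm_teval pn zT.
Qed.

Lemma approximable_le S a b a' b' u :
  approximable S a b u -> a <= a' -> b <= b' -> approximable S a' b' u.
Proof.
by move=> uP aa bb e /uP[p pn up]; exists p => //; exact: tnorm_le_trans pn aa bb.
Qed.

Lemma approximable_eq S a b u u' :
  (forall z, torus z -> u z = u' z) -> approximable S a b u ->
  approximable S a b u'.
Proof.
by move=> uu' uP e /uP[p pn up]; exists p => // z zT; rewrite -uu'// up.
Qed.

Lemma approximable_teval S a b p :
  tnorm_le S a b p -> approximable S a b (teval p).
Proof.
by move=> pn e e0; exists p => // z zT; rewrite subrr cabs0 ltW.
Qed.

Lemma approximable0 S : approximable S 0 0 (fun=> 0).
Proof.
apply: approximable_eq (approximable_teval (tnorm_nil S)) => z _.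
by rewrite /teval big_nil.
Qed.

Lemma approximable1 S : S 0 -> approximable S 1 1 (fun=> 1).
Proof.
move=> S0; apply: approximable_eq (approximable_teval (tnorm_one S0)) => z _.
by rewrite /teval big_seq1 /= zpow0 mulr1.
Qed.

Lemma approximable_limit S a b u :
  (forall e, 0 < e -> exists2 u', approximable S a b u' & unif_dist_le e u u') ->
  approximable S a b u.
Proof.
move=> uP e e0; have e2 : 0 < e / 2 by lra.
have [u' u'P uu'] := uP (e / 2) e2; have [p pn up] := u'P (e / 2) e2.
exists p => // z zT; apply: le_trans (cabs_dist _ _ (u' z)) _.
have := uu' z zT; have := up z zT; lra.
Qed.

Lemma approximableD S a b a' b' u u' :
  approximable S a b u -> approximable S a' b' u' ->
  approximable S (a + a') (b + b') (fun z => u z + u' z).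
Proof.
move=> uP u'P e e0; have e2 : 0 < e / 2 by lra.
have [p pn up] := uP _ e2; have [q qn uq] := u'P _ e2.
exists (p ++ q); first exact: tnorm_cat.
move=> z zT; rewrite teval_cat opprD addrACA.
have := cabsD (u z - teval p z) (u' z - teval q z).
have := up z zT; have := uq z zT; lra.
Qed.

Lemma approximableZ S a b c x u : cabs x <= c ->
  approximable S a b u -> approximable S (c * a) (c * b) (fun z => x * u z).
Proof.
move=> xc uP e e0; have c0 : 0 <= c := le_trans (cabs_ge0 _) xc.
have c1 : 0 < c + 1 by lra.
have [p pn up] := uP _ (divr_gt0 e0 c1).
exists (tscale x p); first exact: tnorm_scale.
move=> z zT; rewrite teval_scale -mulrBr cabsM.
apply: le_trans (ler_pM (cabs_ge0 _) (cabs_ge0 _) xc (up z zT)) _.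
rewrite mulrA ler_pdivrMr//; nra.
Qed.

Lemma approximableM S a b a' b' u u' :
  (forall k l, S k -> S l -> S (k + l)) ->
  approximable S a b u -> approximable S a' b' u' ->
  approximable S (a * a') (K * (b * a' + a * b')) (fun z => u z * u' z).
Proof.
move=> SD uP u'P e e0.
have [a0 _] := approximable_ge0 uP; have [a'0 _] := approximable_ge0 u'P.
(* With both factors approximated within [d], the product is off by at most d (a + a'); the 1 keeps
   the denominator positive. *)
have c0 : 0 < a + a' + 1 by lra.
have [p pn up] := uP _ (divr_gt0 e0 c0); have [q qn uq] := u'P _ (divr_gt0 e0 c0).
exists (tmul p q); first exact: tnorm_mul.
move=> z zT; rewrite teval_mul//.
have -> : u z * u' z - teval p z * teval q z =
  (u z - teval p z) * u' z + teval p z * (u' z - teval q z) by ring.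
apply: le_trans (cabsD _ _) _; rewrite !cabsM.
have h1 := approximable_sup u'P zT; have h2 := tnorm_teval pn zT.
set d := e / _ in up uq; have d0 : 0 < d by rewrite divr_gt0.
have h3 : cabs (u z - teval p z) * cabs (u' z) <= d * a'.
  by apply: ler_pM; rewrite ?cabs_ge0 ?up.
have h4 : cabs (teval p z) * cabs (u' z - teval q z) <= a * d.
  by apply: ler_pM; rewrite ?cabs_ge0 ?uq.
have -> : e = d * (a + a' + 1) by rewrite /d divfK// gt_eqF.
nra.
Qed.

Lemma approximable_sum S (I : Type) (s : seq I) (A B : I -> R)
    (F : I -> Cd -> R[i]) :
  (forall i, approximable S (A i) (B i) (F i)) ->
  approximable S (\sum_(i <- s) A i) (\sum_(i <- s) B i)
    (fun z => \sum_(i <- s) F i z).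
Proof.
move=> FP; elim: s => [|i s ih].
  rewrite !big_nil; apply: approximable_eq (approximable0 S) => z _.
  by rewrite big_nil.
rewrite !big_cons; apply: approximable_eq (approximableD (FP i) ih) => z _.
by rewrite big_cons.
Qed.

Lemma tcoef_sup S a b p k : tnorm_le S a b p -> cabs (tcoef p k) * w k <= b.
Proof.
by move=> [_ _ /(_ k)]; apply: le_trans; rewrite ler_wpM2r// cabs_sum.
Qed.

Lemma tcoef_l1 S a b p s : tnorm_le S a b p -> uniq s ->
  \sum_(k <- s) cabs (tcoef p k) * v k <= a.
Proof.
move=> [_ pa _] us; apply: le_trans pa.
apply: le_trans (@sum_fibre_le _ _ _ fst s p _ us _); last first.
  by move=> x; rewrite mulr_ge0 ?cabs_ge0.
apply: ler_sum => k _; rewrite [leRHS](_ : _ =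
  (\sum_(x <- p | x.1 == k) cabs x.2) * v k).
  by rewrite ler_wpM2r ?cabs_sum.
by rewrite mulr_suml; apply: eq_bigr => x /eqP->.
Qed.

Lemma tcoef_supp S a b p k : tnorm_le S a b p -> ~ S k -> tcoef p k = 0.
Proof.
move=> [pS _ _] Sk; rewrite /tcoef big_seq_cond big1// => x /andP[xp /eqP xk].
by case: Sk; rewrite -xk; exact: pS.
Qed.

(** The way back from approximations to coefficients. Each coefficient is a limit of [tcoef p k],
    and the l^1 bound is passed to the limit over a fixed finite set, on which the weights have a
    finite sum. *)
Lemma approximable_fourier S a b u : approximable S a b u ->
  [/\ forall k, ~ S k -> fourier u k = 0,
      forall k, cabs (fourier u k) * w k <= b &
      sums_le setT (fun k => cabs (fourier u k) * v k) a].
Proof.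
move=> uP; have [C C0 CP] := fourier_approx R m.
have near e : 0 < e -> exists2 p, tnorm_le S a b p &
    forall k, cabs (fourier u k - tcoef p k) <= C * e.
  move=> /uP[p pn up]; exists p => // k.
  exact: CP (approximable_unif uP) _ _ up _.
have split p k : cabs (fourier u k) <=
    cabs (tcoef p k) + cabs (fourier u k - tcoef p k).
  by rewrite -{1}(subrK (tcoef p k) (fourier u k)) addrC cabsD.
split.
- move=> k Sk; apply: cabs_eq0.
  apply: (@le_eps _ _ _ C); first exact: ltW.
  move=> e /near[p pn pk]; rewrite add0r; apply: le_trans (split p k) _.
  by rewrite (tcoef_supp pn Sk) cabs0 add0r -(tcoef_supp pn Sk).
- move=> k; apply: (@le_eps _ _ _ (C * w k)); first by rewrite mulr_ge0// ltW.
  move=> e /near[p pn pk]; apply: le_trans (ler_wpM2r (w_ge0 k) (split p k)) _.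
  rewrite mulrDl lerD ?(tcoef_sup _ pn)// mulrAC.
  by rewrite ler_wpM2r.
- move=> s us _; apply: (@le_eps _ _ _ (C * \sum_(k <- s) v k)).
    by rewrite mulr_ge0 ?sumr_ge0// ltW.
  move=> e /near[p pn pk].
  apply: le_trans (_ : \sum_(k <- s) (cabs (tcoef p k) * v k + C * e * v k) <= _).
    apply: ler_sum => k _; rewrite -mulrDl ler_wpM2r//.
    by apply: le_trans (split p k) _; rewrite lerD2l.
  rewrite big_split lerD ?(tcoef_l1 pn)//= -mulr_sumr.
  by rewrite mulrAC.
Qed.

(** After subtraction of the part over [s0] the remaining series is approximated by polynomials
    supported off [s0], so [a] only has to bound the tail. This is what makes the l^1 norm of the
    remainder small. *)
Lemma approximable_csum_tail S D s0 a b (f : lattice -> R[i]) :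
  (forall k, D k -> S k) -> 0 <= b ->
  uniq s0 -> (forall k, k \in s0 -> D k) ->
  sums_le (D `\` [set` s0]) (fun k => cabs (f k) * v k) a ->
  (forall k, D k -> cabs (f k) * w k <= b) ->
  approximable S a b (fun z => csum D (fun k => f k * zpow z k) -
    \sum_(k <- s0) f k * zpow z k).
Proof.
move=> DS b0 us0 s0D fa fb e e0; have e2 : 0 < e / 2 by lra.
have [s [us sD st]] := sums_le_tail fa e2.
exists [seq (k, f k) | k <- s].
  split => [x||k].
  - by move=> /mapP[k ks ->]; have [] := sD k ks => Dk _; exact: (DS k).
  - by rewrite big_map; exact: fa.
  - rewrite big_map /=; have [ks|ks] := boolP (k \in s).
      rewrite -big_filter filter_pred1_uniq// big_seq1 fb//.
      by have [] := sD k ks.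
    rewrite big_seq_cond big1 ?mul0r// => l /andP[ls /eqP lk].
    by rewrite -lk ls in ks.
move=> z zT; rewrite /teval big_map -addrA -opprD -big_cat.
have -> : e = 2 * (e / 2) by lra.
apply: csum_approx.
- rewrite cat_uniq us0 us andbT; apply/hasPn => k /sD[_ ks0].
  by apply/negP.
- by move=> k; rewrite mem_cat => /orP[/s0D|/sD[]].
move=> t ut tD; apply: le_trans (st t ut _) => [|k kt]; last first.
  have [Dk /=] := tD k kt; rewrite mem_cat => /negP; rewrite negb_or.
  by move=> /andP[/negP ? /negP ?].
apply: ler_sum => k _; rewrite cabsM cabs_zpow// ler_wpM2l ?cabs_ge0//.
exact: weights_v1 vw _.
Qed.

Lemma approximable_csum S D a b (f : lattice -> R[i]) :
  (forall k, D k -> S k) -> 0 <= b ->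
  sums_le D (fun k => cabs (f k) * v k) a ->
  (forall k, D k -> cabs (f k) * w k <= b) ->
  approximable S a b (fun z => csum D (fun k => f k * zpow z k)).
Proof.
move=> DS b0 fa fb.
have D0 : D `\` [set` [::]] = D by apply/seteqP; split => k //= -[].
apply: approximable_eq (@approximable_csum_tail S D [::] a b f DS b0 _ _ _ fb).
- by move=> z _; rewrite big_nil subr0.
- by [].
- by [].
- by rewrite D0.
Qed.

End WeightedApproximation.

(** * Exponential and logarithm *)

Section ScalarSeries.
Variable R : realType.
Implicit Types (x y q e : R) (z w h : R[i]).

Lemma geometric_sum_le q N : 0 <= q < 1 -> \sum_(i < N) q ^+ i <= (1 - q)^-1.
Proof.
move=> /andP[q0 q1]; have q1' : 0 < 1 - q by lra.
rewrite -[leRHS]mul1r ler_pdivlMr//.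
have := subrX1 q N; have := exprn_ge0 N q0; nra.
Qed.

Lemma exprn_small q e : 0 <= q < 1 -> 0 < e -> exists N : nat, q ^+ N <= e.
Proof.
move=> /andP[q0 q1] e0.
have /cvg_expr/cvgrPdist_lt/(_ e e0) : `|q| < 1 by rewrite ger0_norm.
move=> [N _ /(_ N (leqnn N))] /=; rewrite sub0r normrN ger0_norm ?exprn_ge0//.
by exists N; exact: ltW.
Qed.

Lemma mean_value_bound (f df : R -> R) y C :
  (forall t : R, `|t| <= `|y| -> is_derive t (1 : R) f (df t)) ->
  (forall t : R, `|t| <= `|y| -> `|df t| <= C) -> `|f y - f 0| <= C * `|y|.
Proof.
move=> fd fC.
have fc (t : R) : `|t| <= `|y| -> {for t, continuous f}.
  move=> ty; apply: differentiable_continuous; apply/derivable1_diffP.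
  by have [] := fd t ty.
have [y0|y0|->] := ltgtP y 0.
- have [t ty|t|c] := @MVT R f df y 0 y0.
  + by apply: fd; rewrite !ler0_norm; move: ty; rewrite in_itv /=; lra.
  + apply: continuous_in_subspaceT => s; rewrite inE /= in_itv /= => sy.
    by apply: fc; rewrite !ler0_norm; lra.
  rewrite in_itv /= => cy E; rewrite distrC E sub0r normrM normrN.
  by rewrite ler_wpM2r// fC// !ler0_norm; lra.
- have [t ty|t|c] := @MVT R f df 0 y y0.
  + by apply: fd; rewrite !ger0_norm; move: ty; rewrite in_itv /=; lra.
  + apply: continuous_in_subspaceT => s; rewrite inE /= in_itv /= => sy.
    by apply: fc; rewrite !ger0_norm; lra.
  rewrite in_itv /= => cy E; rewrite E subr0 normrM.
  by rewrite ler_wpM2r// fC// !ger0_norm; lra.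
- by rewrite subrr normr0 mulr0.
Qed.

Lemma sin_le_norm y : `|sin y| <= `|y|.
Proof.
have ds (t : R) : `|t| <= `|y| -> is_derive t (1 : R) (@sin R) (cos t).
  by move=> _; exact: is_derive_sin.
have := mean_value_bound ds (fun t _ => cos_max t).
by rewrite sin0 subr0 mul1r.
Qed.

Lemma cos_dist1 y : `|1 - cos y| <= y ^+ 2 / 2.
Proof.
pose u := y / 2; have -> : y = u *+ 2 by rewrite mulr2n /u; lra.
rewrite cos_mulr2n cos2sin2.
have -> : 1 - ((1 - sin u ^+ 2) *+ 2 - 1) = 2 * sin u ^+ 2.
  by rewrite mulr2n; ring.
rewrite ger0_norm; last by rewrite mulr_ge0 ?sqr_ge0.
have -> : (u *+ 2) ^+ 2 / 2 = 2 * u ^+ 2 by rewrite mulr2n; field.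
rewrite ler_pM2l ?ltr0n//.
by rewrite -(real_normK (num_real (sin u))) -(real_normK (num_real u))
  lerXn2r ?nnegrE ?normr_ge0// sin_le_norm.
Qed.

Lemma sin_dist y : `|y| <= 1 -> `|sin y - y| <= y ^+ 2 / 2.
Proof.
move=> y1.
have ds (t : R) : `|t| <= `|y| ->
    is_derive t (1 : R) (fun s : R => sin s - s) (cos t - 1).
  by move=> _; apply: is_derive_eq.
have dC (t : R) : `|t| <= `|y| -> `|cos t - 1| <= `|y| ^+ 2 / 2.
  move=> ty; rewrite distrC; apply: le_trans (cos_dist1 t) _.
  by rewrite -[t ^+ 2]real_normK ?num_real// ler_wpM2r ?invr_ge0// lerXn2r
    ?nnegrE ?normr_ge0.
have := mean_value_bound ds dC; rewrite sin0 subrr subr0 => H.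
apply: le_trans H _; rewrite -[y ^+ 2]real_normK ?num_real//.
by have := normr_ge0 y; nra.
Qed.

Lemma expR_dist x : `|x| <= 2^-1 -> `|expR x - 1 - x| <= 2 * x ^+ 2.
Proof.
rewrite ler_norml => /andP[x1 x2]; have lb := expR_ge1Dx x.
(* The upper bound follows by division, since (1 + x + 2 x^2) (1 - x) = 1 + x^2 (1 - 2 x) is at
   least 1 for x at most 1/2. *)
have ub : expR x * (1 - x) <= 1.
  have := expR_ge1Dx (- x); rewrite expRN => h.
  have e0 := expR_gt0 x.
  have := ler_wpM2l (ltW e0) h; rewrite mulfV ?gt_eqF//.
rewrite ger0_norm; last by lra.
have : 1 <= (1 + x + 2 * x ^+ 2) * (1 - x) by nra.
nra.
Qed.

Lemma cabs_cexp z : cabs (cexp z) = expR (complex.Re z).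
Proof. by rewrite /cexp cabsM cabs_expi mulr1 cabsC ger0_norm ?expR_ge0. Qed.

Lemma cexp_natmul z n : cexp (n%:R * z) = cexp z ^+ n.
Proof.
rewrite /cexp exprMn -rmorphXn -expRM_natl exprnP expiX.
have -> : n%:R * z = (n%:R * complex.Re z) +i* (n%:R * complex.Im z).
  by case: z => a b; rewrite -(rmorph_nat (real_complex R)); simpc.
by [].
Qed.

Lemma cexp_dist h : cabs h <= 2^-1 -> cabs (cexp h - (1 + h)) <= 6 * cabs h ^+ 2.
Proof.
move=> h1; apply: le_trans (cabs_le _) _.
have xh := cabs_Re h; have yh := cabs_Im h.
case: h h1 xh yh => x y; rewrite /cexp /= => h1 xh yh.
rewrite !mul0r subr0 addr0 add0r.
set r := cabs _ in h1 xh yh *.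
have x1 : `|x| <= 2^-1 by exact: le_trans h1.
have y1 : `|y| <= 2^-1 by exact: le_trans h1.
have ex := expR_dist x1; have cy := cos_dist1 y.
have sy : `|sin y - y| <= y ^+ 2 / 2 by apply: sin_dist; lra.
have r0 : 0 <= r := cabs_ge0 _.
have xr : `|x| ^+ 2 <= r ^+ 2 by rewrite lerXn2r ?nnegrE.
have yr : `|y| ^+ 2 <= r ^+ 2 by rewrite lerXn2r ?nnegrE.
rewrite !real_normK ?num_real// in xr yr.
have ex1 : `|expR x - 1| <= 2 * `|x|.
  have -> : expR x - 1 = expR x - 1 - x + x by ring.
  apply: le_trans (ler_normD _ _) _.
  rewrite -[x ^+ 2]real_normK ?num_real// in ex.
  by have := normr_ge0 x; nra.
have ex2 : expR x <= 2 by have := ler_norm (expR x - 1); lra.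
have e0 := expR_gt0 x.
have re : `|expR x * cos y - (1 + x)| <= 3 * r ^+ 2.
  have -> : expR x * cos y - (1 + x) =
    (expR x - 1 - x) - expR x * (1 - cos y) by ring.
  apply: le_trans (ler_normB _ _) _; rewrite normrM (gtr0_norm e0).
  by have := normr_ge0 (1 - cos y); nra.
have im : `|expR x * sin y - y| <= 3 * r ^+ 2.
  have -> : expR x * sin y - y = (expR x - 1) * sin y + (sin y - y) by ring.
  apply: le_trans (ler_normD _ _) _; rewrite normrM.
  have h2 : `|expR x - 1| * `|sin y| <= (2 * r) * r.
    apply: ler_pM => //; first by lra.
    exact: le_trans (sin_le_norm y) yh.
  by nra.
lra.
Qed.

Lemma cabs_subXX z w M N : cabs z <= M -> cabs w <= M ->
  cabs (z ^+ N - w ^+ N) <= N%:R * cabs (z - w) * M ^+ N.-1.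
Proof.
move=> zM wM; rewrite subrXX cabsM [leRHS]mulrAC mulrC.
have M0 : 0 <= M := le_trans (cabs_ge0 _) zM.
rewrite ler_wpM2r ?cabs_ge0//; apply: le_trans (cabs_sum _ _ _) _.
have -> : N%:R * M ^+ N.-1 = \sum_(i < N) M ^+ N.-1.
  by rewrite sumr_const card_ord mulr_natl.
apply: ler_sum => i _; rewrite cabsM !cabsX.
have -> : N.-1 = (N.-1 - i + i)%N by have := ltn_ord i; lia.
rewrite exprD (_ : (N.-1 - i + i - i = N.-1 - i)%N); last by lia.
by rewrite ler_pM ?exprn_ge0 ?cabs_ge0// lerXn2r ?nnegrE ?cabs_ge0.
Qed.

(** With h = z / N both sides are N-th powers, of [cexp h] and of 1 + h. The bases differ by O(1 /
    N^2), and telescoping over N factors leaves O(1 / N). *)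
Lemma cexp_euler_dist z N : (0 < N)%N -> 2 * cabs z <= N%:R ->
  cabs (cexp z - (1 + z / N%:R) ^+ N) <= 6 * cabs z ^+ 2 * expR (cabs z) / N%:R.
Proof.
move=> N0 zN; have NR : 0 < N%:R :> R by rewrite ltr0n.
have NC : N%:R != 0 :> R[i] by rewrite pnatr_eq0 -lt0n.
set h := z / N%:R; have hE : cabs h = cabs z / N%:R.
  by rewrite /h cabsM cabsV -(rmorph_nat (real_complex R)) cabsC gtr0_norm.
have h1 : cabs h <= 2^-1 by rewrite hE ler_pdivrMr//; lra.
have -> : cexp z = cexp h ^+ N by rewrite -cexp_natmul /h mulrC divfK.
have M1 : cabs (cexp h) <= expR (cabs h).
  by rewrite cabs_cexp ler_expR (le_trans (ler_norm _))// cabs_Re.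
have M2 : cabs (1 + h) <= expR (cabs h).
  by rewrite (le_trans (cabsD _ _))// cabs1 expR_ge1Dx.
apply: le_trans (cabs_subXX N M1 M2) _.
have E1 : expR (cabs h) ^+ N.-1 <= expR (cabs z).
  rewrite -expRM_natl ler_expR hE mulrCA ler_piMr ?cabs_ge0//.
  by rewrite ler_pdivrMr// mul1r ler_nat leq_pred.
have := cexp_dist h1; set d := cabs (cexp h - _) => dh.
have d0 : 0 <= d := cabs_ge0 _.
apply: le_trans (ler_wpM2l _ E1) _; first by rewrite mulr_ge0// ltW.
have -> : 6 * cabs z ^+ 2 * expR (cabs z) / N%:R =
    N%:R * (6 * cabs h ^+ 2) * expR (cabs z).
  by rewrite hE; field; rewrite gt_eqF.
by rewrite ler_wpM2r ?expR_ge0// ler_wpM2l// ltW.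
Qed.

Lemma ln_series_dist q x N : q < 1 -> 0 <= x <= q ->
  `|- ln (1 - x) - \sum_(i < N) i.+1%:R^-1 * x ^+ i.+1| <= q ^+ N / (1 - q).
Proof.
move=> q1 /andP[x0 xq]; have q1' : 0 < 1 - q by lra.
have q0 : 0 <= q by lra.
pose f (t : R) := - ln (1 - t) - \sum_(i < N) i.+1%:R^-1 * t ^+ i.+1.
(* By the finite geometric sum this derivative equals t^N / (1 - t), which is small on the whole
   interval, and [f] vanishes at 0. *)
pose df (t : R) := (1 - t)^-1 - \sum_(i < N) t ^+ i.
have f0 : f 0 = 0.
  rewrite /f subr0 ln1 oppr0 add0r big1 ?oppr0// => i _.
  by rewrite expr0n mulr0.
have C0 : 0 <= q ^+ N / (1 - q) by rewrite divr_ge0 ?exprn_ge0// ltW.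
have fd (t : R) : `|t| <= `|x| -> is_derive t (1 : R) f (df t).
  rewrite (ger0_norm x0) ler_norml => tx; have t1 : 0 < 1 - t by lra.
  have dln : is_derive t (1 : R) (fun s : R => ln (1 - s)) (- (1 - t)^-1).
    have dl := is_derive1_ln t1.
    have d1 : is_derive t (1 : R) (fun s : R => 1 - s) (- 1).
      have := is_deriveB (is_derive_cst (1 : R) t (1 : R))
        (is_derive_id t (1 : R)).
      by rewrite sub0r.
    have := @is_derive1_comp R (@ln R) (fun s : R => 1 - s) t _ _ dl d1.
    by rewrite mulrN1.
  have dsum : is_derive t (1 : R)
      (fun s : R => \sum_(i < N) i.+1%:R^-1 * s ^+ i.+1) (\sum_(i < N) t ^+ i).
    rewrite (_ : (fun s : R => _) =
      (\sum_(i < N) (fun s : R => i.+1%:R^-1 * s ^+ i.+1))); last first.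
      by apply/funext => s; rewrite fct_sumE.
    apply: is_derive_sum => i.
    rewrite (_ : (fun s : R => _) = i.+1%:R^-1 \*: (@id R) ^+ i.+1); last first.
      by apply/funext => s; rewrite /= exprfctE.
    apply: is_derive_eq.
    by rewrite /GRing.scale /= mulr1 -mulr_natl mulrA mulVf ?pnatr_eq0// mul1r.
  by apply: is_derive_eq; rewrite /df opprK.
have fC (t : R) : `|t| <= `|x| -> `|df t| <= q ^+ N / (1 - q).
  rewrite (ger0_norm x0) ler_norml => tx; have t1 : 0 < 1 - t by lra.
  have -> : df t = t ^+ N / (1 - t).
    apply: (mulIf (lt0r_neq0 t1)); rewrite divfK ?gt_eqF//.
    rewrite /df mulrBl mulVf ?gt_eqF//.
    by have := subrX1 t N; set s := \sum_(_ < _) _ => h; nra.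
  rewrite normrM normfV (gtr0_norm t1) normrX ler_pM ?invr_ge0 ?exprn_ge0//.
  + exact: ltW.
  + by rewrite lerXn2r ?nnegrE// ler_norml; lra.
  + by rewrite lef_pV2 ?posrE//; lra.
have := mean_value_bound fd fC; rewrite f0 subr0 (ger0_norm x0) => H.
by apply: le_trans H _; rewrite ler_piMr//; lra.
Qed.

End ScalarSeries.

Section LatticeNorm.
Variables (R : realType) (m : nat).
Implicit Types k l : 'rV[int]_m.

Definition lnorm k : R := norm1 (of_lattice R k).

Lemma lnorm_ge0 k : 0 <= lnorm k.
Proof. by apply: sumr_ge0. Qed.

Lemma lnormD k l : lnorm (k + l) <= lnorm k + lnorm l.
Proof.
rewrite /lnorm /norm1 -big_split; apply: ler_sum => i _.
by rewrite !mxE rmorphD ler_normD.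
Qed.

Lemma lnormN k : lnorm (- k) = lnorm k.
Proof. by apply: eq_bigr => i _; rewrite !mxE rmorphN normrN. Qed.

Lemma lnorm0 : lnorm 0 = 0.
Proof. by rewrite /lnorm /norm1 big1// => i _; rewrite !mxE normr0. Qed.

End LatticeNorm.
Arguments lnorm R {m} k.

(** * Powers, exponential and logarithm in the weighted classes *)

Section Collect.
Variables (R : realType) (m : nat).
Implicit Types (p : tpoly R m) (k : 'rV[int]_m).

(** Merging exponents lets cancellation count: the formal terms of a power are only controlled by
    powers of the l^1 norm, the merged coefficients by powers of the sup norm. *)
Definition tcollect p : tpoly R m :=
  [seq (k, tcoef p k) | k <- undup [seq x.1 | x <- p]].

Fixpoint tpow p n : tpoly R m :=
  if n is n'.+1 then tmul p (tpow p n') else [:: (0, 1)].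

Lemma teval_collect p z : teval (tcollect p) z = teval p z.
Proof.
rewrite /teval big_map /tcoef -[RHS](sum_fibre_undup fst).
by apply: eq_bigr => k _; rewrite mulr_suml; apply: eq_bigr => x /eqP <-.
Qed.

Lemma teval_pow p n z : torus z -> teval (tpow p n) z = teval p z ^+ n.
Proof.
move=> zT; elim: n => [|n ih] /=.
  by rewrite /teval big_seq1 zpow0 mulr1.
by rewrite teval_mul// ih exprS.
Qed.

Lemma tpow_supp p n (D : R) : (forall x, x \in p -> lnorm R x.1 <= D) ->
  forall x, x \in tpow p n -> lnorm R x.1 <= n%:R * D.
Proof.
move=> pD; elim: n => [|n ih] x /=.
  by rewrite inE => /eqP-> /=; rewrite lnorm0 mul0r.
move=> /allpairsP[[y z]/= [/pD yp /ih zq ->]] /=.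
rewrite -natr1 mulrDl mul1r addrC; apply: le_trans (lnormD _ _ _) _.
exact: lerD.
Qed.

End Collect.

Section PowerBounded.
Variables (R : realType) (m : nat).
Local Notation lattice := 'rV[int]_m.
Local Notation Cd := 'rV[R[i]]_m.
Variables (v w : lattice -> R) (K : R).
Hypothesis vw : weights v w K.
Implicit Types (p : tpoly R m) (u g : Cd -> R[i]) (S : set lattice)
  (e A a b r : R).
Local Notation approx := (@approximable R m v w).

Let K1 : 1 <= K.
Proof. exact: weights_K vw. Qed.

(** [r] stands for an upper bound of the spectral radius in the weighted algebra, and [b] absorbs
    the failure of submultiplicativity. *)
Definition power_bounded S b r u : Prop :=
  forall n, approx S (b * r ^+ n) (b * r ^+ n) (fun z => u z ^+ n).

(* Only the l^1 norm [e] of [u] enters the growth rate, although the sup norm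
   is not submultiplicative. *)
Lemma approximable_power_bounded S e A u :
  S 0 -> (forall k l, S k -> S l -> S (k + l)) ->
  0 < e -> e <= A -> approx S e A u -> power_bounded S (A / e) (2 * K * e) u.
Proof.
move=> S0 SD e0 eA uP.
have Ae : 1 <= A / e by rewrite ler_pdivlMr// mul1r.
have eK : e <= 2 * K * e by rewrite ler_peMl ?ltW//; have := K1; lra.
(* The sup bounds obey b_{n+1} = K (A e^n + e b_n). With b_n = (A / e) (2 K e)^n both summands are
   at most A (2 K e)^n, and the extra 2 K in the rate absorbs their number and the factor K. *)
have pow n : approx S (e ^+ n) (A / e * (2 * K * e) ^+ n) (fun z => u z ^+ n).
  elim: n => [|n ih].
    by apply: approximable_le (approximable1 vw S0) _ _; rewrite ?expr0 ?mulr1.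
  apply: (@approximable_eq _ _ _ _ _ _ _ (fun z => u z * u z ^+ n)).
    by move=> z _; rewrite exprS.
  apply: approximable_le (approximableM vw SD uP ih) _ _; first by rewrite exprS.
  have en : e ^+ n <= (2 * K * e) ^+ n.
    by rewrite lerXn2r ?nnegrE; lra.
  have -> : e * (A / e * (2 * K * e) ^+ n) = A * (2 * K * e) ^+ n.
    by field; rewrite gt_eqF.
  have -> : A / e * (2 * K * e) ^+ n.+1 = K * (A * (2 * K * e) ^+ n * 2).
    by rewrite exprS; field; rewrite gt_eqF.
  apply: ler_wpM2l; first by have := K1; lra.
  have A0 : 0 <= A by lra.
  rewrite [leRHS](_ : _ = A * (2 * K * e) ^+ n + A * (2 * K * e) ^+ n).
    by rewrite lerD2r ler_wpM2l.
  by set X := _ ^+ n; ring.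
move=> n; apply: approximable_le (pow n) _ _ => //.
have en : e ^+ n <= (2 * K * e) ^+ n.
  by rewrite lerXn2r ?nnegrE; lra.
by apply: le_trans en _; rewrite ler_peMl// exprn_ge0//; lra.
Qed.

(** Binomial expansion. The product inequality is used once per binomial term, so its 2 K goes into
    the constant and the rates simply add. *)
Lemma power_boundedD S b r b' r' u u' :
  (forall k l, S k -> S l -> S (k + l)) ->
  0 <= b -> 0 <= r -> 0 <= b' -> 0 <= r' ->
  power_bounded S b r u -> power_bounded S b' r' u' ->
  power_bounded S (2 * K * (b * b')) (r + r') (fun z => u z + u' z).
Proof.
move=> SD b0 r0 b'0 r'0 uP u'P n.
pose c (i : 'I_n.+1) : R := 'C(n, i)%:R.
pose N (i : 'I_n.+1) : R := c i * (2 * K * (b * r ^+ (n - i) * (b' * r' ^+ i))).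
have term i : approx S (N i) (N i)
    (fun z => 'C(n, i)%:R * (u z ^+ (n - i) * u' z ^+ i)).
  have ci : cabs ('C(n, i)%:R : R[i]) <= c i.
    by rewrite -(rmorph_nat (real_complex R)) cabsC ger0_norm.
  have xy0 : 0 <= b * r ^+ (n - i) * (b' * r' ^+ i).
    by rewrite !mulr_ge0 ?exprn_ge0.
  apply: approximable_le (approximableZ vw ci
    (approximableM vw SD (uP (n - i)%N) (u'P i))) _ _.
  - by rewrite /N ler_wpM2l ?ler0n// ler_peMl//; have := K1; lra.
  - rewrite /N ler_wpM2l ?ler0n//; move: xy0; set X := b * _; set Y := b' * _.
    by lra.
have sumN : \sum_(i <- index_enum 'I_n.+1) N i = 2 * K * (b * b') * (r + r') ^+ n.
  rewrite exprDn mulr_sumr; apply: eq_bigr => i _.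
  by rewrite /N /c -mulr_natl; ring.
rewrite -sumN.
apply: (approximable_eq _ (approximable_sum (index_enum 'I_n.+1) term)).
by move=> z _; rewrite exprDn; apply: eq_bigr => i _; rewrite mulr_natl.
Qed.

(* [(1 + u / N) ^+ N] is used instead of the exponential series because it is a
   polynomial in [u] whose binomial expansion is again bounded by [expR r]. *)
Lemma approximable_cexp S b r u : 0 <= r -> power_bounded S b r u ->
  approx S (b * expR r) (b * expR r) (fun z => cexp (u z)).
Proof.
move=> r0 uP; apply: approximable_limit => e e0.
have b0 : 0 <= b.
  by have [+ _] := approximable_ge0 vw (uP 0%N); rewrite expr0 mulr1.
pose a := b * r; have a0 : 0 <= a by rewrite mulr_ge0.
have ua z : torus z -> cabs (u z) <= a.
  by move=> zT; have := approximable_sup vw (uP 1%N) zT; rewrite !expr1.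
(* The two summands secure the hypothesis of [cexp_euler_dist] and an error of at most [e]. *)
pose N := (Num.bound (2 * a) + Num.bound (6 * a ^+ 2 * expR a / e)).+1.
have a2 : 0 <= 2 * a by rewrite mulr_ge0.
have N1 : 2 * a <= N%:R.
  apply: le_trans (ltW (archi_boundP a2)) _; by rewrite ler_nat /N; lia.
have a6 : 0 <= 6 * a ^+ 2 * expR a / e.
  by rewrite divr_ge0 ?(ltW e0)// !mulr_ge0 ?expR_ge0 ?exprn_ge0.
have N2 : 6 * a ^+ 2 * expR a / e <= N%:R.
  apply: le_trans (ltW (archi_boundP a6)) _; by rewrite ler_nat /N; lia.
have NR : 0 < N%:R :> R by rewrite ltr0n.
have NC : N%:R != 0 :> R[i] by rewrite pnatr_eq0.
exists (fun z => (1 + u z / N%:R) ^+ N); last first.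
  move=> z zT; have uz := ua z zT; have u0 := cabs_ge0 (u z).
  apply: le_trans (cexp_euler_dist _ _) _ => //; first by lra.
  rewrite ler_pdivrMr//; rewrite ler_pdivrMr// in N2; rewrite [leRHS]mulrC.
  apply: le_trans N2; rewrite ler_pM ?expR_ge0 ?ler_expR//.
    by rewrite mulr_ge0 ?sqr_ge0.
  by rewrite ler_wpM2l// lerXn2r ?nnegrE.
pose d : R[i] := N%:R^-1.
have dE : cabs d = N%:R^-1.
  by rewrite /d cabsV -(rmorph_nat (real_complex R)) cabsC gtr0_norm.
pose c (i : 'I_N.+1) : R := 'C(N, i)%:R / N%:R ^+ i.
pose T (i : 'I_N.+1) : R := c i * (b * r ^+ i).
have term i : approx S (T i) (T i) (fun z => ('C(N, i)%:R * d ^+ i) * u z ^+ i).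
  apply: (approximableZ vw _ (uP i)); rewrite cabsM cabsX dE /c exprVn.
  by rewrite -(rmorph_nat (real_complex R)) cabsC ger0_norm.
have sumT : \sum_(i <- index_enum 'I_N.+1) T i = b * (1 + r / N%:R) ^+ N.
  rewrite exprDn mulr_sumr; apply: eq_bigr => i _.
  by rewrite /T /c expr1n mul1r exprMn exprVn -mulr_natl; ring.
have T_le : b * (1 + r / N%:R) ^+ N <= b * expR r.
  rewrite ler_wpM2l//.
  have -> : expR r = expR (r / N%:R) ^+ N.
    by rewrite -expRM_natl mulrC divfK// gt_eqF.
  rewrite lerXn2r ?nnegrE ?expR_ge0 ?expR_ge1Dx//.
  by rewrite addr_ge0// divr_ge0.
apply: (approximable_le _ T_le T_le); rewrite -sumT.
apply: (approximable_eq _ (approximable_sum (index_enum 'I_N.+1) term)).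
move=> z _; rewrite exprDn; apply: eq_bigr => i _.
by rewrite expr1n mul1r exprMn -mulr_natl -/d; ring.
Qed.

(** Two rates are at work: [q] bounds the values and gives uniform convergence of the series on the
    torus, while [r] bounds the weighted norms of its partial sums by a geometric series. *)
Lemma approximable_ln S b r q (x : Cd -> R) u :
  S 0 -> 0 <= r < 1 -> q < 1 ->
  (forall z, torus z -> u z = (x z)%:C /\ 0 <= x z <= q) ->
  power_bounded S b r u ->
  approx S (b / (1 - r)) (b / (1 - r)) (fun z => (- ln (1 - x z))%:C).
Proof.
move=> S0 r01 q1 ux uP; apply: approximable_limit => e e0.
have b0 : 0 <= b.
  by have [+ _] := approximable_ge0 vw (uP 0%N); rewrite expr0 mulr1.
have q0 : 0 <= q.
  have /(ux _)[_ /andP[]] : torus (const_mx 1 : Cd).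
    by move=> i; rewrite mxE normr1.
  exact: le_trans.
have q1' : 0 < 1 - q by lra.
have q01 : 0 <= q < 1 by rewrite q0.
have [N qN] := exprn_small q01 (mulr_gt0 e0 q1').
exists (fun z => \sum_(i < N) i.+1%:R^-1 * u z ^+ i.+1); last first.
  move=> z zT; have [-> xq] := ux z zT.
  have -> : \sum_(i < N) i.+1%:R^-1 * (x z)%:C ^+ i.+1 =
      (\sum_(i < N) i.+1%:R^-1 * x z ^+ i.+1)%:C.
    rewrite rmorph_sum; apply: eq_bigr => i _.
    by rewrite rmorphM rmorphXn fmorphV rmorph_nat.
  rewrite -rmorphB cabsC; apply: le_trans (ln_series_dist N q1 xq) _.
  by rewrite ler_pdivrMr.
pose T (i : 'I_N) : R := i.+1%:R^-1 * (b * r ^+ i.+1).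
have term i : approx S (T i) (T i) (fun z => i.+1%:R^-1 * u z ^+ i.+1).
  apply: (approximableZ vw _ (uP i.+1)).
  by rewrite cabsV -(rmorph_nat (real_complex R)) cabsC gtr0_norm// ltr0n.
have T_le : \sum_(i <- index_enum 'I_N) T i <= b / (1 - r).
  apply: le_trans (ler_wpM2l b0 (geometric_sum_le N r01)).
  rewrite mulr_sumr; apply: ler_sum => i _; case/andP: r01 => r0 r1.
  rewrite /T exprS mulrCA ler_wpM2l// mulrA ler_piMl ?exprn_ge0//.
  have i1 : i.+1%:R^-1 <= 1 :> R by rewrite invf_le1 ?ltr0n// ler1n.
  by apply: mulr_ile1 => //; rewrite ?invr_ge0// ltW.
apply: (approximable_le _ T_le T_le).
exact: (approximable_sum (index_enum 'I_N) term).
Qed.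

(* Collecting equal exponents bounds the coefficients of [p ^+ n] by the n-th
   power of the sup norm of [p] on the torus; the support only grows
   linearly. *)
Lemma tpoly_power_bounded p (D Q C delta B : R) :
  (forall x, x \in p -> lnorm R x.1 <= D) ->
  (forall z, torus z -> cabs (teval p z) <= Q) ->
  0 < delta -> 0 <= D ->
  (forall k, v k <= C * expR (delta * lnorm R k)) ->
  (forall k, w k <= C * expR (delta * lnorm R k)) ->
  sums_le setT (fun k : lattice => expR (- delta * lnorm R k)) B ->
  exists2 b, 0 <= b &
    power_bounded setT b (expR (2 * delta * D) * Q) (teval p).
Proof.
move=> pD pQ delta0 D0 vC wC sB.
have [K0 K00 K0P] := tcoef_bound R m.
have Q0 : 0 <= Q.
  apply: le_trans (cabs_ge0 _) (pQ (const_mx 1) _).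
  by move=> i; rewrite mxE normr1.
have C0 : 0 <= C.
  have := vC 0; rewrite lnorm0 mulr0 expR0 mulr1; apply: le_trans.
  by rewrite (weights_v0 vw).
have B0 : 0 <= B.
  by have := sB [::]; rewrite big_nil; apply.
exists (K0 * C * (B + 1)); first by rewrite !mulr_ge0 ?addr_ge0// ltW.
move=> n e e0; pose q := tpow p n; exists (tcollect q); last first.
  by move=> z zT; rewrite teval_collect teval_pow// subrr cabs0 ltW.
have qQ k : cabs (tcoef q k) <= K0 * Q ^+ n.
  apply: K0P => z zT; rewrite teval_pow// cabsX lerXn2r ?nnegrE ?cabs_ge0//.
  exact: pQ.
have qD k : k \in undup [seq x.1 | x <- q] -> lnorm R k <= n%:R * D.
  by rewrite mem_undup => /mapP[x xq ->]; exact: tpow_supp xq.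
(* On the support |k| <= n D, so e^(delta |k|) is at most e^(2 delta n D) e^(- delta |k|): the
   second delta buys a summable factor. *)
set E := expR (2 * delta * D).
have En : expR (2 * delta * (n%:R * D)) = E ^+ n.
  by rewrite /E -expRM_natl; congr expR; ring.
rewrite exprMn -En; set F := expR _.
have F0 : 0 <= F := expR_ge0 _.
have KQ0 : 0 <= K0 * Q ^+ n by rewrite mulr_ge0 ?exprn_ge0// ltW.
split => //.
- rewrite big_map /=.
  apply: le_trans (_ : \sum_(k <- undup [seq x.1 | x <- q])
      K0 * Q ^+ n * C * F * expR (- delta * lnorm R k) <= _).
    rewrite big_seq [leRHS]big_seq; apply: ler_sum => k /qD kD.
    have -> : K0 * Q ^+ n * C * F * expR (- delta * lnorm R k) =
      (K0 * Q ^+ n) * (C * (F * expR (- delta * lnorm R k))) by ring.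
    apply: ler_pM; rewrite ?cabs_ge0//.
      exact: le_trans ler01 (weights_v1 vw k).
    apply: le_trans (vC k) _; rewrite ler_wpM2l// /F -expRD ler_expR.
    by have := ler_wpM2l (ltW delta0) kD; lra.
  rewrite -mulr_sumr.
  have := sB _ (undup_uniq [seq x.1 | x <- q]) (fun _ _ => I).
  set s := \sum_(_ <- _) _ => sBs.
  have -> : K0 * C * (B + 1) * (F * Q ^+ n) =
    K0 * Q ^+ n * C * F * (B + 1) by ring.
  apply: ler_wpM2l; last by lra.
  by rewrite !mulr_ge0 ?exprn_ge0 ?(ltW K00).
- move=> k; rewrite big_map /=.
  have [ks|ks] := boolP (k \in undup [seq x.1 | x <- q]); last first.
    rewrite big_seq_cond big1 ?mul0r; last first.
      by move=> l /andP[ls /eqP lk]; rewrite -lk ls in ks.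
    by rewrite !mulr_ge0 ?addr_ge0 ?exprn_ge0// ltW.
  rewrite -big_filter filter_pred1_uniq ?undup_uniq// big_seq1.
  apply: le_trans (_ : (K0 * Q ^+ n) * (C * F) <= _).
    apply: ler_pM; rewrite ?cabs_ge0 ?(weights_w_ge0 vw)//.
    apply: le_trans (wC k) _; rewrite ler_wpM2l// /F ler_expR.
    have := ler_wpM2l (ltW delta0) (qD k ks).
    have := mulr_ge0 (ltW delta0) (mulr_ge0 (ler0n R n) D0); lra.
  have -> : K0 * C * (B + 1) * (F * Q ^+ n) =
    K0 * Q ^+ n * (C * F) * (B + 1) by ring.
  rewrite ler_peMr//; last by lra.
  by rewrite !mulr_ge0 ?exprn_ge0 ?(ltW K00).
Qed.

End PowerBounded.

(** * Lattice sums and weights *)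

Section LatticeSums.
Variable R : realType.

Lemma sums_le_inj (T T' : choiceType) (g : T' -> T) (F : T -> R) (B : R) :
  injective g -> sums_le setT F B -> sums_le setT (F \o g) B.
Proof.
move=> ginj FB s us _ /=; rewrite -(big_map g predT F).
by apply: FB => //; rewrite map_inj_uniq.
Qed.

Lemma sums_le_leq (T : choiceType) (D : set T) (F G : T -> R) (B : R) :
  (forall k, F k <= G k) -> sums_le D G B -> sums_le D F B.
Proof.
by move=> FG GB s us sD; apply: le_trans (GB s us sD); apply: ler_sum.
Qed.

Lemma sums_le_nat (h : nat -> R) (B : R) : (forall n, 0 <= h n) ->
  (forall N, \sum_(i < N) h i <= B) -> sums_le setT h B.
Proof.
move=> h0 hB s us _; pose N := (\max_(i <- s) i).+1.
have sN i : i \in s -> (i < N)%N by move=> si; rewrite ltnS leq_bigmax_seq.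
apply: le_trans (hB N); rewrite -(big_mkord predT h) /index_iota subn0.
rewrite [leRHS](bigID (fun i => i \in s))/= -[leLHS]addr0.
apply: lerD; last exact: sumr_ge0.
suff -> : \sum_(i <- s) h i = \sum_(i <- iota 0 N | i \in s) h i by [].
rewrite -[RHS]big_filter; apply: perm_big; apply: uniq_perm;
  rewrite ?filter_uniq ?iota_uniq// => i.
rewrite mem_filter mem_iota /= add0n; case si: (i \in s) => //=.
by rewrite sN.
Qed.

Lemma sums_le_int (h : nat -> R) (B : R) : sums_le setT h B ->
  sums_le setT (fun j : int => h `|j|%N) (B + B).
Proof.
move=> hB s us _; rewrite (bigID (fun j : int => 0 <= j))/=.
have half (P : pred int) : {in P &, injective absz} ->
    \sum_(j <- s | P j) h `|j|%N <= B.
  move=> Pinj; rewrite -big_filter -(big_map absz predT h); apply: hB => //.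
  rewrite map_inj_in_uniq ?filter_uniq// => x y.
  rewrite !mem_filter => /andP[Px _] /andP[Py _]; exact: Pinj.
apply: lerD; apply: half => -[] x [] y; rewrite !unfold_in /= => // _ _.
  by move=> ->.
by move=> [->].
Qed.

(** Fubini for finite sums: group the points by first coordinate; within a group the tails are
    distinct and the induction hypothesis applies. *)
Lemma sums_le_prod (f : int -> R) (B : R) m : (forall j, 0 <= f j) ->
  sums_le setT f B ->
  sums_le setT (fun k : 'rV[int]_m => \prod_(i < m) f (k ord0 i)) (B ^+ m).
Proof.
move=> f0 fB; have B0 : 0 <= B by have := fB [::]; rewrite big_nil; apply.
elim: m => [|m ih] s us _.
  under eq_bigr do rewrite big_ord0.
  rewrite expr0; case: s us => [|x [|y s]] us; rewrite ?big_nil ?big_seq1//.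
  by move: us; rewrite /= (thinmx0 x) (thinmx0 y) mem_head.
rewrite -(sum_fibre_undup (fun k : 'rV[int]_m.+1 => k ord0 ord0)).
set t := undup _; have ut : uniq t by exact: undup_uniq.
apply: (@le_trans _ _ (\sum_(j <- t) f j * B ^+ m)).
  apply: ler_sum => j _.
  rewrite (eq_bigr (fun k : 'rV[int]_m.+1 =>
    f j * \prod_(i < m) f (ktail k ord0 i))); last first.
    move=> k /eqP kj; rewrite big_ord_recl kj; congr (_ * _).
    by apply: eq_bigr => i _; rewrite mxE.
  rewrite -mulr_sumr ler_wpM2l// -big_filter.
  rewrite -(big_map (@ktail m) predT (fun l => \prod_(i < m) f (l ord0 i))).
  apply: ih => //; rewrite map_inj_in_uniq ?filter_uniq// => x y.
  rewrite !mem_filter => /andP[/eqP xj _] /andP[/eqP yj _] xy.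
  apply/eqP; rewrite -subr_eq0 ktail_eq0 !mxE xj yj subrr eqxx andbT.
  apply/eqP/rowP => i; rewrite !mxE.
  by have := congr1 (fun l : 'rV[int]_m => l ord0 i) xy; rewrite !mxE => ->;
    rewrite subrr.
rewrite -mulr_suml exprS ler_wpM2r ?exprn_ge0//.
exact: fB.
Qed.

Lemma lnorm_ge m (k : 'rV[int]_m) i : `|k ord0 i|%N%:R <= lnorm R k.
Proof.
rewrite /lnorm /norm1 (bigD1 i)//= mxE.
have -> : `|(k ord0 i)%:~R| = `|k ord0 i|%N%:R :> R.
  by rewrite -intr_norm -natr_absz.
by rewrite lerDl sumr_ge0.
Qed.

Lemma sums_le_expR m (d : R) : 0 < d ->
  exists B, sums_le setT (fun k : 'rV[int]_m => expR (- d * lnorm R k)) B.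
Proof.
move=> d0; pose q := expR (- d).
have q01 : 0 <= q < 1 by rewrite expR_ge0 expR_lt1; lra.
pose h (n : nat) := q ^+ n.
have hB : sums_le setT h (1 - q)^-1.
  apply: sums_le_nat => [n|N]; first by rewrite exprn_ge0 ?expR_ge0.
  exact: geometric_sum_le.
exists (((1 - q)^-1 + (1 - q)^-1) ^+ m).
have := @sums_le_prod (fun j : int => h `|j|%N) _ m _ (sums_le_int hB).
move=> H; apply: sums_le_leq (H _) => [k|j]; last by rewrite exprn_ge0 ?expR_ge0.
rewrite /h /q /lnorm /norm1 mulr_sumr expR_sum; apply: ler_prod => i _.
rewrite expR_ge0 /= -expRM_natl mulrC mxE.
by rewrite -intr_norm -natr_absz.
Qed.

Lemma powR_sum_le (s : R) N : 1 < s ->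
  \sum_(i < N) (i.+1%:R : R) `^ (- s) <= 1 + (s - 1)^-1.
Proof.
move=> s1; pose d := s - 1; have d0 : 0 < d by rewrite /d; lra.
(* The added term is minus the tail of the integral of t^(-s), which makes the induction close. The
   step rests on ln (1 - 1 / y) <= - 1 / y and 1 + u <= e^u. *)
suff H M : \sum_(i < M.+1) (i.+1%:R : R) `^ (- s) <=
    1 + (1 - M.+1%:R `^ (- d)) / d.
  case: N => [|M]; first by rewrite big_ord0 addr_ge0// invr_ge0 ltW.
  by apply: le_trans (H M) _; rewrite -/d lerD2l ler_pdivrMr// mulVf ?gt_eqF//
    gerDl oppr_le0 powR_ge0.
elim: M => [|M ih].
  by rewrite big_ord_recl big_ord0 powR1 subrr mul0r.
rewrite big_ord_recr /=; apply: le_trans (lerD ih (lexx _)) _.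
rewrite -addrA lerD2l -lerBrDl -mulrBl ler_pdivlMr//.
set y : R := M.+2%:R; have y0 : 0 < y by rewrite ltr0n.
have x0 : 0 < M.+1%:R :> R by rewrite ltr0n.
have yx : M.+1%:R = y - 1 :> R by rewrite /y -[M.+2%:R]natr1 addrK.
have y2 : 1 < y by rewrite ltr1n.
clearbody y.
have lnx : ln (M.+1%:R : R) <= ln y - y^-1.
  have -> : M.+1%:R = y * (1 - y^-1) by rewrite yx mulrBr mulr1 mulfV ?gt_eqF.
  have yi : y^-1 < 1 by rewrite invf_lt1.
  rewrite lnM ?posrE ?subr_gt0//.
  by rewrite lerD2l; apply: le_ln1Dx; rewrite ltrN2.
have E1 : (M.+1%:R : R) `^ (- d) >= y `^ (- d) * (1 + d / y).
  rewrite /powR !gt_eqF//.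
  apply: le_trans (_ : expR (- d * ln y) * expR (d / y) <= _).
    by rewrite ler_wpM2l ?expR_ge0// expR_ge1Dx.
  rewrite -expRD ler_expR; have := ler_wpM2l (ltW d0) lnx; lra.
have E2 : y `^ (- s) = y `^ (- d) / y.
  have -> : - s = - d + - 1 by rewrite /d; lra.
  by rewrite powRD ?(gt_eqF y0) ?implybT// powR_inv1// ltW.
rewrite E2; move: E1; rewrite mulrDr mulr1 => E1.
have -> : y `^ (- d) / y * d = y `^ (- d) * (d / y) by ring.
by lra.
Qed.

(** The weight is split into n + 1 equal powers of exponent s = a / (n + 1) > 1, and in the i-th one
    |k| is lowered to |k_i|; the sum then factors over the coordinates. *)
Lemma sums_le_powR n (a : R) : n.+1%:R < a ->
  exists B, sums_le setT (fun k : 'rV[int]_n.+1 => (1 + lnorm R k) `^ (- a)) B.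
Proof.
move=> na; pose s := a / n.+1%:R.
have n0 : 0 < n.+1%:R :> R by rewrite ltr0n.
have s1 : 1 < s by rewrite ltr_pdivlMr// mul1r.
pose h (j : nat) : R := j.+1%:R `^ (- s).
have hB : sums_le setT h (1 + (s - 1)^-1).
  apply: sums_le_nat => [j|N]; [exact: powR_ge0|exact: powR_sum_le].
have := @sums_le_prod (fun j : int => h `|j|%N) _ n.+1 _ (sums_le_int hB).
set B := _ ^+ _ => H; exists B.
apply: sums_le_leq (H _) => [k|j]; last exact: powR_ge0.
have l0 := lnorm_ge0 R k.
have -> : (1 + lnorm R k) `^ (- a) = \prod_(i < n.+1) (1 + lnorm R k) `^ (- s).
  rewrite prodr_const card_ord -powR_mulrn ?powR_ge0// -powRrM; congr powR.
  by rewrite /s; field; rewrite gt_eqF.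
apply: ler_prod => i _; rewrite powR_ge0 /= /h !powRN lef_pV2 ?posrE ?powR_gt0//.
- apply: ge0_ler_powR; rewrite ?nnegrE ?addr_ge0//; first by lra.
  by rewrite -natr1 addrC lerD2l lnorm_ge.
- by lra.
Qed.

End LatticeSums.

Section Weights.
Variables (R : realType) (m : nat).
Local Notation lattice := 'rV[int]_m.

Definition exp_weight (b : R) (k : lattice) : R := expR (b * lnorm R k).

(** The 1-norm is used here as well, so that both weights share [lnorm]; the Euclidean norm is
    recovered in the theorem at the price of a constant. *)
Definition pow_weight (a : R) (k : lattice) : R := (1 + lnorm R k) `^ a.

Lemma exp_weights b : 0 <= b -> weights (exp_weight b) (exp_weight b) 1.
Proof.
move=> b0.
have eD k l : exp_weight b (k + l) <= exp_weight b k * exp_weight b l.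
  by rewrite /exp_weight -expRD ler_expR -mulrDr ler_wpM2l// lnormD.
split => //.
- by rewrite /exp_weight lnorm0 mulr0 expR0.
- by rewrite /exp_weight lnorm0 mulr0 expR0.
- by move=> k; rewrite /exp_weight -expR0 ler_expR mulr_ge0// lnorm_ge0.
- by move=> k; exact: expR_ge0.
- move=> k l; rewrite mul1r; apply: le_trans (eD k l) _.
  by rewrite lerDl mulr_ge0 ?expR_ge0.
Qed.

Lemma pow_weight_ge1 a k : 0 <= a -> 1 <= pow_weight a k.
Proof.
move=> a0; rewrite /pow_weight -[leLHS](powRr0 (1 + lnorm R k)) ler_powR//.
by rewrite lerDl lnorm_ge0.
Qed.

(** The inequality for [w] holds because 1 + |k + l| is at most 2 (1 + max(|k|, |l|)). *)
Lemma pow_weights a : 0 <= a -> weights (fun=> 1) (pow_weight a) (2 `^ a).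
Proof.
move=> a0; split => //.
- by rewrite -[leLHS](powRr0 2) ler_powR// ler1n.
- by rewrite /pow_weight lnorm0 addr0 powR1.
- by move=> k; exact: powR_ge0.
- by move=> k l; rewrite mulr1.
- move=> k l; rewrite mulr1 mul1r /pow_weight.
  have lk := lnorm_ge0 R k; have ll := lnorm_ge0 R l.
  wlog kl : k l lk ll / lnorm R k <= lnorm R l => [H|].
    have [h|h] := leP (lnorm R k) (lnorm R l); first exact: H.
    have := H l k ll lk (ltW h); by rewrite [l + k]addrC [X in _ <= _ * X]addrC.
  apply: le_trans (_ : 2 `^ a * (1 + lnorm R l) `^ a <= _).
    rewrite -powRM ?addr_ge0//; apply: ge0_ler_powR => //.
    - by rewrite nnegrE addr_ge0 ?lnorm_ge0.
    - by rewrite nnegrE mulr_ge0 ?addr_ge0.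
    - by have := lnormD R k l; lra.
  by rewrite ler_wpM2l ?powR_ge0// lerDr powR_ge0.
Qed.

Lemma pow_weight_growth a d : 0 < a -> 0 < d ->
  exists2 C, 1 <= C & forall k, pow_weight a k <= C * expR (d * lnorm R k).
Proof.
move=> a0 d0; pose c := d / a; have c0 : 0 < c by rewrite divr_gt0.
(* Multiply ln (c x) <= c x by [a], for x = 1 + |k| and c = d / a. The maximum with 1 lets the same
   constant also dominate the weight [v] = 1. *)
exists (Num.max 1 (expR (d - a * ln c))); first by rewrite le_max lexx.
move=> k; apply: le_trans (_ : expR (d - a * ln c) * expR (d * lnorm R k) <= _).
  have x0 : 0 < 1 + lnorm R k by have := lnorm_ge0 R k; lra.
  rewrite /pow_weight /powR gt_eqF// -expRD ler_expR.
  have : ln (c * (1 + lnorm R k)) <= c * (1 + lnorm R k).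
    by rewrite ltW// ln_sublinear// mulr_gt0.
  rewrite lnM ?posrE// => H; have := ler_wpM2l (ltW a0) H.
  have -> : a * (c * (1 + lnorm R k)) = d + d * lnorm R k.
    by rewrite /c; field; rewrite gt_eqF.
  lra.
by rewrite ler_wpM2r ?expR_ge0// le_max lexx orbT.
Qed.

End Weights.

(** * The Wiener-Hopf factor *)

Section SymbolBounds.
Variables (R : realType) (m : nat).
Local Notation lattice := 'rV[int]_m.
Local Notation Cd := 'rV[R[i]]_m.

(** Pulled back to the compact cube [-pi, pi]^m, [u] is a uniform limit of continuous functions. For
    the symbol, this turns pointwise positivity into a positive lower bound. *)
Lemma torus_min (u : Cd -> R[i]) : unif_approx u ->
  exists2 z0, torus z0 &
    forall z, torus z -> complex.Re (u z0) <= complex.Re (u z).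
Proof.
move=> uP; pose f (t : 'rV[R]_m) := u (map_mx (@expi R) t).
have [fc _] : ccontinuous f.
  apply: ccontinuous_unif_approx => e /uP[p up].
  exists (fun t => teval p (map_mx (@expi R) t)); first exact: ccontinuous_teval.
  by move=> t; exact/up/torus_expi.
pose K := [set t : 'rV[R]_m | forall i, `[- pi, pi]%classic (t ord0 i)].
have Kc : compact K.
  apply: (@rV_compact _ _ (fun=> `[- pi, pi]%classic)) => i.
  exact: segment_compact.
have pi0 := pi_ge0 R.
have K0 : K !=set0.
  by exists 0 => i /=; rewrite mxE in_itv /= oppr_le0 pi0.
have [t0 _ t0P] := EVT_min_rV K0 Kc (continuous_subspaceT fc).
exists (map_mx (@expi R) t0); first exact: torus_expi.
move=> z zT; have [t zt] : exists2 t, K t & z = map_mx (@expi R) t.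
  have /choice[t tP] i : exists s : R, z ord0 i = expi s /\ - pi <= s <= pi.
    by have [s zs spi] := unit_expi (torus_cabs i zT); exists s.
  exists (\row_i t i).
    by move=> i; rewrite /= mxE in_itv /=; have [] := tP i.
  by apply/rowP => i; rewrite !mxE; have [] := tP i.
by move=> ->; apply: t0P; rewrite inE.
Qed.

End SymbolBounds.

Section LogOmega.
Variables (R : realType) (n : nat).
Local Notation lattice := 'rV[int]_n.+1.
Local Notation Cd := 'rV[R[i]]_n.+1.
Variable phi : 'rV[R]_n.+1 -> R.
Hypothesis phi_pos : forall z : Cd, torus z -> 0 < cardinal_symbol phi z.

Let c (k : lattice) : R[i] := (phi (of_lattice R k))%:C.

Let sigma z : R := complex.Re (cardinal_symbol phi z).

Lemma cardinal_symbol_real (z : Cd) : torus z ->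
  cardinal_symbol phi z = (sigma z)%:C.
Proof.
move=> /phi_pos; rewrite ltcE /= => /andP[/eqP im _].
by apply: complex_eqP; rewrite /= ?im.
Qed.

Lemma cardinal_symbol_bounds B :
  sums_le setT (fun k => `|phi (of_lattice R k)|) B ->
  exists mu M : R, 0 < mu <= M /\
    forall z : Cd, torus z -> mu <= sigma z <= M.
Proof.
move=> phiB.
have w1 : weights (fun _ : lattice => 1 : R) (fun=> 1) 1.
  by split => // *; rewrite ?mulr1 ?mul1r// lerDl.
have symP : approximable (fun=> 1) (fun=> 1) setT B B (cardinal_symbol phi).
  apply: (approximable_csum w1) => //.
  - by have := phiB [::]; rewrite big_nil; apply.
  - move=> s us sD; apply: le_trans (phiB s us sD).
    by apply: ler_sum => k _; rewrite mulr1 cabsC.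
  - move=> k _; rewrite mulr1 cabsC.
    by have := phiB [:: k]; rewrite big_seq1; apply.
have [z0 z0T z0P] := torus_min (approximable_unif symP).
have mu0 : 0 < sigma z0.
  by have := phi_pos z0T; rewrite cardinal_symbol_real// ltcR.
have sB z : torus z -> sigma z <= B.
  move=> zT; have h := approximable_sup w1 symP zT.
  exact: le_trans (ler_norm _) (le_trans (cabs_Re _) h).
exists (sigma z0), B; split; first by rewrite mu0; exact: sB.
by move=> z zT; apply/andP; split; [exact: z0P|exact: sB].
Qed.

Lemma approximable_log_omega (v w : lattice -> R)
    (K mu M eta A D C delta B : R) s0 :
  weights v w K ->
  0 < mu <= M -> (forall z : Cd, torus z -> mu <= sigma z <= M) ->
  eta = (mu / M) / 4 ->
  uniq s0 -> (forall k, k \in s0 -> lnorm R k <= D) -> 0 <= D ->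
  sums_le (setT `\` [set` s0])
    (fun k => `|phi (of_lattice R k)| * v k) (M * (eta / (2 * K))) ->
  (forall k, `|phi (of_lattice R k)| * w k <= A) ->
  0 < delta ->
  expR (2 * delta * D) * (1 - mu / M + eta) <= 1 - mu / M + 2 * eta ->
  (forall k, v k <= C * expR (delta * lnorm R k)) ->
  (forall k, w k <= C * expR (delta * lnorm R k)) ->
  sums_le setT (fun k : lattice => expR (- delta * lnorm R k)) B ->
  exists a, approximable v w setT a a (log_omega phi).
Proof.
move=> vw /andP[mu0 muM] sigmaP etaE us0 s0D D0 tailP supP delta0 growth vC wC sB.
have M0 : 0 < M := lt_le_trans mu0 muM.
have K1 := weights_K vw.
have muM0 : 0 < mu / M by rewrite divr_gt0.
have muM1 : mu / M <= 1 by rewrite ler_pdivrMr// mul1r.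
have eta0 : 0 < eta by rewrite etaE divr_gt0.
have K20 : 0 < 2 * K by lra.
pose e := eta / (2 * K); have e0 : 0 < e by rewrite divr_gt0.
have eeta : e <= eta by rewrite ler_pdivrMr//; nra.
pose g z : R[i] := 1 - M^-1%:C * cardinal_symbol phi z.
pose x z : R := 1 - sigma z / M.
have gx z : torus z -> g z = (x z)%:C /\ 0 <= x z <= 1 - mu / M.
  move=> zT; have /andP[s1 s2] := sigmaP z zT; split.
    rewrite /g cardinal_symbol_real// -rmorphM /x mulrC.
    by rewrite rmorphB.
  rewrite /x subr_ge0 ler_pdivrMr// mul1r s2 /=.
  by rewrite lerD2l lerN2 ler_pM2r ?invr_gt0.
pose d : R[i] := (- M^-1)%:C.
(* [p] is [g] with the symbol truncated to [s0], so g - p is a multiple of a tail of the symbol. *)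
pose p : tpoly R n.+1 := (0, 1) :: tscale d [seq (k, c k) | k <- s0].
have pE z : teval p z = 1 + d * \sum_(k <- s0) c k * zpow z k.
  rewrite /p /teval big_cons /= zpow0 mulr1 -/(teval _ _) teval_scale.
  by rewrite /teval big_map.
have A0 : 0 <= A.
  by apply: le_trans (supP 0); rewrite mulr_ge0 ?normr_ge0 ?(weights_w_ge0 vw).
(* The sup bound is enlarged by [e] because [approximable_power_bounded] wants it to be at least the
   l^1 bound; [e] is chosen so that 2 K e = eta. *)
have rest : approximable v w setT e (M^-1 * A + e) (fun z => g z - teval p z).
  have dM : cabs d <= M^-1 by rewrite cabsC normrN ger0_norm ?invr_ge0 ?(ltW M0).
  have := @approximable_csum_tail _ _ _ _ _ vw setT setT s0 (M * e) A c
    (fun _ _ => I) A0 us0 (fun _ _ => I).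
  move=> H; have {}H : approximable v w setT (M * e) A (fun z =>
      cardinal_symbol phi z - \sum_(k <- s0) c k * zpow z k).
    apply: H => [s us sD|k _]; last by rewrite cabsC.
    apply: le_trans (tailP s us sD).
    by apply: ler_sum => k _; rewrite cabsC.
  have := approximableZ vw dM H; rewrite mulrA mulVf ?gt_eqF// mul1r => H'.
  apply: (@approximable_eq _ _ _ _ _ _ _ (fun z => d * (cardinal_symbol phi z -
      \sum_(k <- s0) c k * zpow z k))).
    move=> z _; rewrite pE /g /d rmorphN; ring.
  by apply: (approximable_le H'); rewrite // lerDl ltW.
have pQ z : torus z -> cabs (teval p z) <= 1 - mu / M + eta.
  move=> zT; have [gxz /andP[x0 x1]] := gx z zT.
  have -> : teval p z = g z - (g z - teval p z) by ring.
  apply: le_trans (cabsD _ _) _; rewrite cabsN lerD//.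
    by rewrite gxz cabsC ger0_norm.
  exact: le_trans (approximable_sup vw rest zT) eeta.
have pD y : y \in p -> lnorm R y.1 <= D.
  rewrite inE => /orP[/eqP->|]; first by rewrite lnorm0.
  by move=> /mapP[y' /mapP[k ks ->] ->]; exact: s0D.
have [b b0 pP] := tpoly_power_bounded vw pD pQ delta0 D0 vC wC sB.
set rho := expR (2 * delta * D) * _ in growth pP.
have rho0 : 0 <= rho by rewrite mulr_ge0 ?expR_ge0//; lra.
have eA : e <= M^-1 * A + e by rewrite lerDr mulr_ge0 ?invr_ge0 ?(ltW M0).
have restP := approximable_power_bounded vw I (fun _ _ _ _ => I) e0 eA rest.
have b'0 : 0 <= (M^-1 * A + e) / e by rewrite divr_ge0 ?(le_trans (ltW e0))// ltW.
have Ke : 2 * K * e = eta by rewrite /e mulrC divfK// gt_eqF.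
have Ke0 : 0 <= 2 * K * e by rewrite Ke ltW.
have gP := power_boundedD vw (fun _ _ _ _ => I) b0 rho0 b'0 Ke0 pP restP.
have gP' : power_bounded v w setT
    (2 * K * (b * ((M^-1 * A + e) / e))) (rho + 2 * K * e) g.
  move=> N; apply: approximable_eq (gP N) => z _.
  by congr (_ ^+ N); ring.
have r1 : 0 <= rho + 2 * K * e < 1.
  by rewrite addr_ge0//= Ke; rewrite etaE in growth *; lra.
have q1 : 1 - mu / M < 1 by lra.
have lnP := approximable_ln vw I r1 q1 gx gP'.
set a := _ / (1 - _) in lnP.
pose lM : R := `|ln M|.
exists (lM * 1 + a).
have constP : approximable v w setT (lM * 1) (lM * 1) (fun=> (- ln M)%:C * 1).
  apply: (approximableZ vw); last exact: (approximable1 vw I).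
  by rewrite cabsC normrN.
apply: approximable_eq (approximableD constP lnP) => z zT.
have /andP[s1 s2] := sigmaP z zT; have s0' : 0 < sigma z by lra.
rewrite /log_omega /omega cardinal_symbol_real// -fmorphV /= mulr1 -rmorphD.
congr (_%:C); rewrite /x subKr lnV ?posrE// ln_div ?posrE//.
by ring.
Qed.

End LogOmega.

Section WienerHopf.
Variables (R : realType) (n : nat).
Local Notation lattice := 'rV[int]_n.+1.
Variable phi : 'rV[R]_n.+1 -> R.
Variables (v w : lattice -> R) (K : R).
Hypothesis vw : weights v w K.

Lemma half_set0 (H : half_lattice n) : half_set H 0.
Proof.
case: H => [|le] /=; last exact: lo_refl.
by rewrite /upper_lattice /= mxE.
Qed.

Lemma half_setD (H : half_lattice n) k l :
  half_set H k -> half_set H l -> half_set H (k + l).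
Proof.
case: H => [|le] /=; first by rewrite /upper_lattice /= mxE; exact: addr_ge0.
move=> k0 l0; apply: (lo_trans l0).
by have := lo_add l k0; rewrite add0r.
Qed.

(** Both norms depend only on absolute values of coefficients, so restriction to any part of the
    lattice cannot increase them. The 2 counts the two pieces of [Lambda_plus], with the factor 1/2
    bounded by 1. *)
Lemma approximable_Lambda_plus a (H : half_lattice n) :
  approximable v w setT a a (log_omega phi) ->
  approximable v w (half_set H) (2 * a) (2 * a) (Lambda_plus phi H).
Proof.
move=> logP; have [a0 _] := approximable_ge0 vw logP.
have [_ supP sumP] := approximable_fourier vw logP.
have part (D : set lattice) : (forall k, D k -> half_set H k) ->
    approximable v w (half_set H) a a
      (fun z => csum D (fun k => lambda phi k * zpow z k)).
  move=> DH; apply: (approximable_csum vw) => // [s us _|k _].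
    exact: sumP.
  exact: supP.
have half : cabs (2^-1 : R[i]) <= 1.
  rewrite cabsV -(rmorph_nat (real_complex R)) cabsC ger0_norm//.
  by rewrite invf_le1// ler1n.
rewrite mulr_natl mulr2n -{1 3}(mul1r a).
case: H part => [|le] part /=.
- apply: approximableD; first apply: (approximableZ vw half).
  + by apply: part => k /= k0; rewrite /half_set /upper_lattice /= k0.
  + by apply: part => k /= k0; exact: ltW k0.
- have l0 : cabs (lambda phi 0) <= a.
    have := sumP [:: 0]; rewrite big_seq1 (weights_v0 vw) mulr1; apply => //.
  apply: approximableD; last by apply: part => k [].
  apply: (approximableZ vw half).
  have S0 : half_set (Cone le) 0 by exact: half_set0.
  have := approximableZ vw l0 (approximable1 vw S0).
  by rewrite !mulr1.
Qed.

(** [a'] is chosen before [H], which makes the constants of the algebraic case uniform in the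
    half-space. *)
Lemma approximable_omega_plus a :
  approximable v w setT a a (log_omega phi) ->
  exists2 a', 0 < a' & forall H,
    approximable v w (half_set H) a' a' (omega_plus phi H).
Proof.
move=> logP; have [a0 _] := approximable_ge0 vw logP.
have K1 := weights_K vw.
pose e := 2 * a + 1; have e0 : 0 < e by rewrite /e; lra.
exists (e / e * expR (2 * K * e)).
  by rewrite mulr_gt0 ?expR_gt0// divr_gt0.
move=> H; apply: (approximable_cexp vw); first by rewrite mulr_ge0 ?ltW//; lra.
apply: (approximable_power_bounded vw) => //.
- exact: half_set0.
- exact: half_setD.
- apply: approximable_le (approximable_Lambda_plus H logP) _ _; rewrite /e; lra.
Qed.

End WienerHopf.

(** * The semi-cardinal coefficients *)

Section SemiCoefficients.
Variables (R : realType) (n : nat).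
Local Notation lattice := 'rV[int]_n.+1.
Local Notation Cd := 'rV[R[i]]_n.+1.
Variable phi : 'rV[R]_n.+1 -> R.
Variables (v w : lattice -> R) (K : R).
Hypothesis vw : weights v w K.
Variables (H : half_lattice n) (a : R).
Hypothesis omegaP : approximable v w (half_set H) a a (omega_plus phi H).
Implicit Types (j k : lattice).

Lemma gamma_supp k : ~ half_set H k -> gamma phi H k = 0.
Proof. by have [+ _ _] := approximable_fourier vw omegaP; apply. Qed.

Lemma gamma_sup k : cabs (gamma phi H k) * w k <= a.
Proof. by have [_ + _] := approximable_fourier vw omegaP; apply. Qed.

Lemma gamma_sums : sums_le setT (fun k => cabs (gamma phi H k)) a.
Proof.
have [_ _ gP] := approximable_fourier vw omegaP.
apply: sums_le_leq gP => k; rewrite ler_peMr ?cabs_ge0//.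
exact: weights_v1 vw k.
Qed.

Let psi j z := zpow z j * omega_plus phi H (zinv z).

(** The reflection is carried out on approximating polynomials, which replaces a change of variables
    in the iterated integral. *)
Lemma fourier_reflected j k : fourier (psi j) k = gamma phi H (j - k).
Proof.
have [C C0 CP] := fourier_approx R n.+1.
pose refl (p : tpoly R n.+1) : tpoly R n.+1 := [seq (j - x.1, x.2) | x <- p].
have reflP p e : unif_dist_le e (omega_plus phi H) (teval p) ->
    unif_dist_le e (psi j) (teval (refl p)).
  move=> up z zT; have -> : teval (refl p) z = zpow z j * teval p (zinv z).
    rewrite /teval big_map mulr_sumr; apply: eq_bigr => x _ /=.
    by rewrite zpow_zinv zpowD//; ring.
  by rewrite -mulrBr cabsM cabs_zpow// mul1r; exact/up/torus_zinv.
have psi_approx : unif_approx (psi j).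
  by move=> e /omegaP[p _ up]; exists (refl p); exact: reflP.
apply/eqP; rewrite -subr_eq0; apply/eqP/cabs_eq0.
apply: (@le_eps _ _ _ (C + C)); first by rewrite addr_ge0// ltW.
move=> e /omegaP[p pn up]; rewrite add0r mulrDl.
apply: le_trans (cabs_dist _ _ (tcoef p (j - k))) (lerD _ _).
  have -> : tcoef p (j - k) = tcoef (refl p) k.
    rewrite /tcoef big_map; apply: eq_bigl => x /=.
    by apply/eqP/eqP => [->|<-]; rewrite opprB addrC subrK.
  exact: CP psi_approx _ _ (reflP _ _ up) k.
by rewrite cabsB; exact: CP (approximable_unif omegaP) _ _ up _.
Qed.

(** The convolution formula for a_{k,j} is never stated for the limits: gamma_{k-m} is replaced by
    coefficients of a polynomial near [omega_plus], and the projected factor by a finite partial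
    sum. *)
Lemma semi_coef_bound j k (B : R) : (forall l, 0 < w l) ->
  sums_le [set m | half_set H (j - m) /\ half_set H (k - m)]
    (fun m => (w (j - m) * w (k - m))^-1) B ->
  cabs (semi_coef phi H k j) <= a ^+ 2 * B.
Proof.
move=> w0 sB; have [a0 _] := approximable_ge0 vw omegaP.
have [C C0 CP] := fourier_approx R n.+1.
pose D := half_set H.
pose f m := gamma phi H (j - m).
have fsum : sums_le D (fun m => cabs (f m)) a.
  move=> s us _; apply: (sums_le_inj _ gamma_sums) => // x y /addrI.
  exact: oppr_inj.
have gamma_le m : cabs (gamma phi H m) <= a / w m.
  by rewrite ler_pdivlMr// gamma_sup.
have near e : 0 < e -> exists2 p, unif_dist_le e (semi_symbol phi H j) (teval p) &
    cabs (tcoef p k) <= a ^+ 2 * B.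
  move=> e0; have c0 : 0 < 3 * a + 1 by lra.
  (* The projected factor contributes 2 d a to the error and [omega_plus] contributes d a. *)
  pose d := e / (3 * a + 1); have d0 : 0 < d by rewrite divr_gt0.
  have de : d * (3 * a + 1) = e by rewrite divfK// gt_eqF.
  clearbody d.
  have [p pn up] := omegaP d0.
  have [s [us sD st]] := sums_le_tail fsum d0.
  pose q : tpoly R n.+1 := [seq (m, f m) | m <- s].
  exists (tmul p q).
    move=> z zT; rewrite teval_mul// /semi_symbol /P_plus.
    have -> : csum (half_set H) (fun m => fourier (psi j) m * zpow z m) =
        csum D (fun m => f m * zpow z m).
      by congr csum; apply/funext => m; rewrite fourier_reflected.
    set g := csum _ _.
    have gq : cabs (g - teval q z) <= 2 * d.
      rewrite /teval big_map; apply: csum_approx => // t ut tD.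
      apply: le_trans (st t ut tD); apply: ler_sum => m _.
      by rewrite cabsM cabs_zpow// mulr1.
    have qa : cabs (teval q z) <= a.
      rewrite /teval big_map; apply: le_trans (cabs_sum _ _ _) _.
      apply: le_trans (fsum s us sD); apply: ler_sum => m _.
      by rewrite cabsM cabs_zpow// mulr1.
    have oa := approximable_sup vw omegaP zT.
    have oz := up z zT.
    have -> : omega_plus phi H z * g - teval p z * teval q z =
      omega_plus phi H z * (g - teval q z) +
      (omega_plus phi H z - teval p z) * teval q z by ring.
    apply: le_trans (cabsD _ _) _.
    rewrite (cabsM (omega_plus phi H z)) (cabsM (_ - teval p z)).
    have h1 : cabs (omega_plus phi H z) * cabs (g - teval q z) <= a * (2 * d).
      by apply: ler_pM; rewrite ?cabs_ge0.
    have h2 : cabs (omega_plus phi H z - teval p z) * cabs (teval q z) <= d * a.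
      by apply: ler_pM; rewrite ?cabs_ge0.
    by apply: le_trans (lerD h1 h2) _; rewrite -de; lra.
  rewrite tcoef_mul big_map /=; apply: le_trans (cabs_sum _ _ _) _.
  (* Other terms vanish by the supports of [gamma] and of [p]. The restriction is essential for
     [exp_kernel_upper], which needs nonnegative last coordinates. *)
  rewrite (bigID (fun m => `[< D (j - m) /\ D (k - m) >]))/=.
  rewrite [X in _ + X]big1 ?addr0; last first.
    move=> m; rewrite asbool_and negb_and => /orP[] /asboolPn Dm.
      by rewrite /f gamma_supp// mulr0 cabs0.
    by rewrite (tcoef_supp pn Dm) mul0r cabs0.
  apply: le_trans (_ : \sum_(m <- [seq m <- s | `[< D (j - m) /\ D (k - m) >]])
    a ^+ 2 * (w (j - m) * w (k - m))^-1 <= _); last first.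
    rewrite -mulr_sumr ler_wpM2l ?sqr_ge0//; apply: sB.
      by rewrite filter_uniq.
    by move=> m; rewrite mem_filter => /andP[/asboolP].
  rewrite big_filter; apply: ler_sum => m _; rewrite cabsM invfM.
  have -> : a ^+ 2 * ((w (j - m))^-1 * (w (k - m))^-1) =
    (a / w (k - m)) * (a / w (j - m)) by ring.
  apply: ler_pM; rewrite ?cabs_ge0//.
  - by rewrite ler_pdivlMr// (tcoef_sup vw _ pn).
  - exact: gamma_le.
have semi_approx : unif_approx (semi_symbol phi H j).
  by move=> e e0; have [p up _] := near e e0; exists p.
apply: (@le_eps _ _ _ C); first exact: ltW.
move=> e e0; have [p up pB] := near e e0.
rewrite /semi_coef -(subrK (tcoef p k) (fourier _ _)).
apply: le_trans (cabsD _ _) _; rewrite addrC lerD//.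
exact: CP semi_approx _ _ up k.
Qed.

End SemiCoefficients.

(** * Comparison of norms and convolution of weights *)

Section NormComparison.
Variables (R : realType) (m : nat).
Implicit Type x : 'rV[R]_m.

Lemma norm2_ge0 x : 0 <= norm2 x.
Proof. exact: sqrtr_ge0. Qed.

Lemma norm2_le_norm1 x : norm2 x <= norm1 x.
Proof.
have x0 : 0 <= norm1 x by apply: sumr_ge0.
rewrite /norm2 -(ger0_norm x0) -sqrtr_sqr ler_sqrt ?sqr_ge0//.
rewrite expr2 {1}/norm1 mulr_suml; apply: ler_sum => i _.
rewrite -real_normK ?num_real// expr2 ler_wpM2l//.
by rewrite /norm1 (bigD1 i)//= lerDl sumr_ge0.
Qed.

Lemma norm1_le_norm2 x : norm1 x <= m%:R * norm2 x.
Proof.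
apply: le_trans (_ : \sum_(i < m) norm2 x <= _); last first.
  by rewrite sumr_const card_ord mulr_natl.
apply: ler_sum => i _; rewrite -sqrtr_sqr ler_sqrt ?sumr_ge0//.
- by rewrite (bigD1 i)//= lerDl sumr_ge0// => j _; exact: sqr_ge0.
- by move=> j _; exact: sqr_ge0.
Qed.

End NormComparison.

Section Kernels.
Variables (R : realType) (n : nat).
Local Notation lattice := 'rV[int]_n.+1.
Implicit Types (j k m : lattice) (D : set lattice).

Lemma sums_le_reflect (F : lattice -> R) (B : R) j :
  sums_le setT F B -> sums_le setT (fun m => F (j - m)) B.
Proof. by apply: sums_le_inj => x y /addrI; exact: oppr_inj. Qed.

Lemma sums_le_scale2 D (F G : lattice -> R) (c B : R) : 0 <= c ->
  sums_le setT F B -> sums_le setT G B ->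
  sums_le D (fun m => c * (F m + G m)) (c * (2 * B)).
Proof.
move=> c0 FB GB s us _; rewrite -mulr_sumr ler_wpM2l// big_split /=.
by have := FB s us (fun _ _ => I); have := GB s us (fun _ _ => I); lra.
Qed.

Lemma subr_triangle j k m : lnorm R (k - j) <= lnorm R (k - m) + lnorm R (j - m).
Proof.
have -> : k - j = (k - m) + (- (j - m)) by rewrite opprB addrA subrK.
by apply: le_trans (lnormD _ _ _) _; rewrite lnormN.
Qed.

(** Dividing w(k - j) <= 2^a (w(k - m) + w(j - m)) by all three weights bounds the product of two
    inverse weights by their sum, times the wanted decay. *)
Lemma pow_kernel D (a B : R) j k : 0 <= a ->
  sums_le setT (fun l : lattice => (1 + lnorm R l) `^ (- a)) B ->
  sums_le D (fun m => (pow_weight a (j - m) * pow_weight a (k - m))^-1)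
    (2 `^ a / pow_weight a (k - j) * (2 * B)).
Proof.
move=> a0 sB.
have w0 (l : lattice) : 0 < pow_weight a l.
  exact: lt_le_trans ltr01 (pow_weight_ge1 l a0).
have wV (l : lattice) : (pow_weight a l)^-1 = (1 + lnorm R l) `^ (- a).
  by rewrite powRN.
have c0 : 0 <= 2 `^ a / pow_weight a (k - j) by rewrite divr_ge0 ?powR_ge0.
have sum2 := sums_le_scale2 (D := D) c0 (sums_le_reflect j sB)
  (sums_le_reflect k sB).
apply: sums_le_leq sum2 => m.
rewrite -!wV /= invfM.
have wD : pow_weight a (k - j) <=
    2 `^ a * (pow_weight a (k - m) + pow_weight a (j - m)).
  have := weights_wD (pow_weights n.+1 a0) (k - m) (- (j - m)).
  have -> : (k - m) + - (j - m) = k - j by rewrite opprB addrA subrK.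
  by rewrite /pow_weight lnormN mulr1 mul1r.
have := w0 (k - m); have := w0 (j - m); have := w0 (k - j).
move: wD; set x := pow_weight _ _; set y := pow_weight _ _.
set z := pow_weight _ _; set c := 2 `^ a => xyz x0 z0 y0.
clearbody x y z c.
have -> : z^-1 * y^-1 = (x^-1 * x) / (z * y).
  by rewrite mulVf ?gt_eqF// mul1r invfM.
have -> : c / x * (z^-1 + y^-1) = (x^-1 * (c * (y + z))) / (z * y).
  by field; rewrite !gt_eqF.
rewrite ler_wpM2r ?invr_ge0 ?mulr_ge0 ?(ltW y0) ?(ltW z0)//.
by rewrite ler_wpM2l// invr_ge0 ltW.
Qed.

Lemma exp_weight_kernelE (b : R) j k m :
  (exp_weight b (j - m) * exp_weight b (k - m))^-1 =
  expR (- b * (lnorm R (k - m) + lnorm R (j - m))).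
Proof. by rewrite /exp_weight -expRD -expRN; congr expR; ring. Qed.

(** The rate is split as b = b' + (b - b'): the first part gives the decay through the triangle
    inequality, the second pays for the sum over m. *)
Lemma exp_kernel D (b b' B : R) j k : 0 < b' < b ->
  sums_le setT (fun l : lattice => expR (- (b - b') * lnorm R l)) B ->
  sums_le D (fun m => (exp_weight b (j - m) * exp_weight b (k - m))^-1)
    (expR (- b' * lnorm R (k - j)) * (2 * B)).
Proof.
move=> /andP[b'0 b'b] sB.
have sum2 := sums_le_scale2 (D := D) (expR_ge0 (- b' * lnorm R (k - j)))
  (sums_le_reflect j sB) (sums_le_reflect k sB).
apply: sums_le_leq sum2 => m.
rewrite exp_weight_kernelE [leRHS]mulrDr -!expRD.
apply: le_trans (_ : expR (- b' * lnorm R (k - j) +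
  - (b - b') * lnorm R (j - m)) <= _); last by rewrite lerDl expR_ge0.
rewrite ler_expR; have := ler_wpM2l (ltW b'0) (subr_triangle j k m).
have : 0 <= (b - b') * lnorm R (k - m).
  by rewrite mulr_ge0 ?lnorm_ge0// subr_ge0 ltW.
lra.
Qed.

Lemma lnorm_col' (k : lattice) : lnorm R k =
  norm1 (of_lattice R (col' ord_max k)) + `|of_lattice R k ord0 ord_max|.
Proof.
rewrite /lnorm /norm1 big_ord_recr /=; congr (_ + _); apply: eq_bigr => i _.
rewrite !mxE; congr (`|(k _ _)%:~R|); apply: val_inj.
by rewrite /= /bump leqNgt ltn_ord.
Qed.

(* In the last coordinate both k - m and j - m are nonnegative, so their sum is
   |k_d - j_d| plus twice the smaller one: the rate b survives in that
   coordinate, and the excess pays for the summation over m. *)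
Lemma exp_kernel_upper (b b' B : R) j k : 0 < b' < b ->
  sums_le setT (fun l : lattice => expR (- (b - b') * lnorm R l)) B ->
  sums_le [set m | @upper_lattice n (j - m) /\ @upper_lattice n (k - m)]
    (fun m => (exp_weight b (j - m) * exp_weight b (k - m))^-1)
    (expR (- b' * norm1 (of_lattice R (col' ord_max (k - j)))
           - b * `|of_lattice R (k - j) ord0 ord_max|) * (2 * B)).
Proof.
move=> /andP[b'0 b'b] sB s us sD; set E := expR _.
apply: le_trans (_ : \sum_(m <- s) E * (expR (- (b - b') * lnorm R (j - m)) +
    expR (- (b - b') * lnorm R (k - m))) <= _); last first.
  exact: (sums_le_scale2 (D := setT) (expR_ge0 _) (sums_le_reflect j sB)
    (sums_le_reflect k sB)).
rewrite big_seq [leRHS]big_seq; apply: ler_sum => m /sD[jm km].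
rewrite exp_weight_kernelE [leRHS]mulrDr -!expRD !lnorm_col'.
have tri : norm1 (of_lattice R (col' ord_max (k - j))) <=
    norm1 (of_lattice R (col' ord_max (k - m))) +
    norm1 (of_lattice R (col' ord_max (j - m))).
  have -> : col' ord_max (k - j) = col' ord_max k - col' ord_max j.
    by apply/matrixP => x y; rewrite !mxE.
  have -> : col' ord_max (k - m) = col' ord_max k - col' ord_max m.
    by apply/matrixP => x y; rewrite !mxE.
  have -> : col' ord_max (j - m) = col' ord_max j - col' ord_max m.
    by apply/matrixP => x y; rewrite !mxE.
  set x := col' _ k; set y := col' _ j; set z := col' _ m.
  have -> : x - y = (x - z) + (- (y - z)) by rewrite opprB addrA subrK.
  by apply: le_trans (lnormD R _ _) _; rewrite lnormN.
have last_ge0 l : @upper_lattice n l -> 0 <= of_lattice R l ord0 ord_max.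
  by rewrite /upper_lattice /= mxE ler0z.
have P0 := last_ge0 _ km; have Q0 := last_ge0 _ jm.
have PQ : of_lattice R (k - j) ord0 ord_max =
    of_lattice R (k - m) ord0 ord_max - of_lattice R (j - m) ord0 ord_max.
  by rewrite !mxE -rmorphB; congr (_%:~R); ring.
rewrite PQ (ger0_norm P0) (ger0_norm Q0).
have tk0 : 0 <= norm1 (of_lattice R (col' ord_max (k - m))) by apply: sumr_ge0.
have tj0 : 0 <= norm1 (of_lattice R (col' ord_max (j - m))) by apply: sumr_ge0.
move: tri P0 Q0 tk0 tj0.
set t := norm1 _; set tk := norm1 _; set tj := norm1 _.
set P := of_lattice R (k - m) _ _; set Q := of_lattice R (j - m) _ _.
move=> tri P0 Q0 tk0 tj0.
have d0 : 0 <= b - b' by lra.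
have bt := ler_wpM2l (ltW b'0) tri.
(* The summable factor is taken at the point with the smaller last coordinate, say P: the excess 2 b
   P there covers (b - b') P. *)
have [PQle|QPle] := leP P Q.
- apply: (@le_trans _ _ (expR (- b' * t - b * `|P - Q| + - (b - b') * (tk + P)))).
    rewrite ler_expR ler0_norm ?subr_le0//.
    have h1 := mulr_ge0 d0 tj0.
    have h2 : 0 <= (b + b') * P by rewrite mulr_ge0; lra.
    lra.
  by rewrite lerDr expR_ge0.
- apply: (@le_trans _ _ (expR (- b' * t - b * `|P - Q| + - (b - b') * (tj + Q)))).
    rewrite ler_expR ger0_norm ?subr_ge0 ?(ltW QPle)//.
    have h1 := mulr_ge0 d0 tk0.
    have h2 : 0 <= (b + b') * Q by rewrite mulr_ge0; lra.
    lra.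
  by rewrite lerDl expR_ge0.
Qed.

End Kernels.

(** * Choice of the rate and the final estimates *)

Lemma small_exponent (R : realType) (x y D d0 : R) :
  0 < x < y -> 0 <= D -> 0 < d0 ->
  exists2 d, 0 < d <= d0 & expR (2 * d * D) * x <= y.
Proof.
move=> /andP[x0 xy] D0 d00; have y0 := lt_trans x0 xy.
have l0 : 0 < ln (y / x) by rewrite ln_gt0// ltr_pdivlMr// mul1r.
(* D + 1 in place of D allows D = 0. *)
pose q := ln (y / x) / (2 * (D + 1)).
have D1 : 0 < 2 * (D + 1) by lra.
have q0 : 0 < q by rewrite divr_gt0.
exists (Num.min d0 q); first by rewrite lt_min d00 q0 ge_min lexx.
set d := Num.min _ _; have dq : d <= q by rewrite ge_min lexx orbT.
have d_gt0 : 0 < d by rewrite lt_min d00.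
rewrite -ler_pdivlMr// -[leRHS]lnK ?posrE ?divr_gt0// ler_expR.
have : d * (2 * (D + 1)) <= ln (y / x) by rewrite -ler_pdivlMr.
lra.
Qed.

Section Decay.
Variables (R : realType) (n : nat).
Local Notation lattice := 'rV[int]_n.+1.
Variable phi : 'rV[R]_n.+1 -> R.
Hypothesis phi_pos : forall z, torus z -> 0 < cardinal_symbol phi z.

Let f (k : lattice) : R := `|phi (of_lattice R k)|.

(* The rate [d] is fixed before [v] and [w], because it becomes the exponent of
   the exponential weights; [v0] only serves to control the tail uniformly. *)
Lemma log_omega_weighted (v0 : lattice -> R) (K B d0 : R) :
  1 <= K -> 0 < d0 -> (forall k, 1 <= v0 k) ->
  sums_le setT (fun k => f k * v0 k) B ->
  exists2 d, 0 < d <= d0 & forall (v w : lattice -> R) A C,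
    weights v w K -> (forall k, v k <= v0 k) ->
    (forall k, f k * w k <= A) ->
    (forall k, v k <= C * expR (d * lnorm R k)) ->
    (forall k, w k <= C * expR (d * lnorm R k)) ->
    exists a, approximable v w setT a a (log_omega phi).
Proof.
move=> K1 d00 v01 fB.
have f0 k : 0 <= f k by exact: normr_ge0.
have fB' : sums_le setT f B by apply: sums_le_leq fB => k; rewrite ler_peMr.
have [mu [M [muM symP]]] := cardinal_symbol_bounds phi_pos fB'.
have /andP[mu0 muM'] := muM; have M0 : 0 < M := lt_le_trans mu0 muM'.
have r0 : 0 < mu / M by rewrite divr_gt0.
have r1 : mu / M <= 1 by rewrite ler_pdivrMr// mul1r.
pose eta := mu / M / 4; have eta0 : 0 < eta by rewrite divr_gt0.
have e0 : 0 < M * (eta / (2 * K)).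
  by rewrite mulr_gt0// divr_gt0//; lra.
have [s0 [us0 _ tailP]] := sums_le_tail fB e0.
(* A crude bound for the radius of [s0]; only its finiteness matters. *)
pose D := \sum_(k <- s0) lnorm R k.
have D0 : 0 <= D by apply: sumr_ge0 => k _; exact: lnorm_ge0.
have s0D k : k \in s0 -> lnorm R k <= D.
  move=> ks; rewrite /D (bigD1_seq k)//= lerDl sumr_ge0// => l _.
  exact: lnorm_ge0.
have xy : 0 < 1 - mu / M + eta < 1 - mu / M + 2 * eta.
  by apply/andP; split; lra.
have [d dd0 growth] := small_exponent xy D0 d00.
exists d => // v w A C vw vv0 fw vC wC.
have /andP[d_gt0 _] := dd0.
have [S sS] := sums_le_expR n.+1 d_gt0.
apply: (@approximable_log_omega _ _ phi phi_pos v w K mu M eta A D C d S s0)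
  => //.
by apply: sums_le_leq tailP => k; rewrite ler_wpM2l.
Qed.

End Decay.

Unset Implicit Arguments.

Theorem theorem3p7 (R : realType) (n : nat) (phi : 'rV[R]_n.+1 -> R)
  (phi_cont : continuous phi)
  (phi_sym : forall x, phi (- x) = phi x)
  (phi_fin : (amalgam_norm phi < +oo)%E)
  (phi_pos : forall z, torus z -> 0 < cardinal_symbol phi z) :
  (forall alpha : R, n.+1%:R < alpha ->
    (exists2 C0 : R, 0 < C0 &
      forall x, `|phi x| <= C0 * (1 + norm2 x) `^ (- alpha)) ->
    exists C1 C2 : R, [/\ 0 < C1, 0 < C2 &
      forall H : half_lattice n,
        (forall k, half_set H k ->
          `|gamma phi H k| <=
            (C1 * (1 + norm2 (of_lattice R k)) `^ (- alpha))%:C) /\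
        (forall j k, half_set H j -> half_set H k ->
          `|semi_coef phi H k j| <=
            (C2 * (1 + norm2 (of_lattice R (k - j))) `^ (- alpha))%:C)])
  /\
  (forall alpha : R, 0 < alpha ->
    (exists2 C0 : R, 0 < C0 &
      forall x, `|phi x| <= C0 * expR (- alpha * norm1 x)) ->
    forall H : half_lattice n,
    exists beta C1 : R, [/\ 0 < beta < alpha, 0 < C1,
      (forall k, half_set H k ->
        `|gamma phi H k| <=
          (C1 * expR (- beta * norm1 (of_lattice R k)))%:C) &
      forall beta' : R, 0 < beta' < beta ->
        exists C2 : R, [/\ 0 < C2,
          (forall j k, half_set H j -> half_set H k ->
            `|semi_coef phi H k j| <=
              (C2 * expR (- beta' * norm1 (of_lattice R (k - j))))%:C) &
          half_set H = @upper_lattice n ->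
          forall j k, half_set H j -> half_set H k ->
            `|semi_coef phi H k j| <=
              (C2 * expR (- beta' * norm1 (of_lattice R (col' ord_max (k - j)))
                          - beta * `|of_lattice R (k - j) ord0 ord_max|))%:C]]).
Proof.
split.
- move=> alpha an [C0 C00 phiP].
  have n0 : 0 < n.+1%:R :> R by rewrite ltr0n.
  have a0 : 0 < alpha by exact: lt_trans an.
  have [S sS] := sums_le_powR an.
  have S0 : 0 <= S by have := sS [::]; rewrite big_nil; apply.
  pose w := pow_weight alpha : 'rV[int]_n.+1 -> R.
  have vw := pow_weights n.+1 (ltW a0).
  have w1 k : 1 <= w k by apply: pow_weight_ge1; exact: ltW.
  have w0 k : 0 < w k := lt_le_trans ltr01 (w1 k).
  have wV k : (w k)^-1 = (1 + lnorm R k) `^ (- alpha) by rewrite powRN.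
  (* The factor comes from 1 + |x| <= (n + 1) (1 + ||x||). *)
  pose A := C0 * n.+1%:R `^ alpha.
  have phiA k : `|phi (of_lattice R k)| <= A / w k.
    apply: le_trans (phiP _) _; rewrite /A -mulrA ler_wpM2l ?(ltW C00)//.
    set x := of_lattice R k; have x0 := norm2_ge0 x.
    have p0 : 0 < (1 + norm2 x) `^ alpha by rewrite powR_gt0//; lra.
    rewrite powRN ler_pdivlMr// mulrC ler_pdivrMr//.
    rewrite -powRM ?(ltW n0) ?addr_ge0//; apply: ge0_ler_powR; rewrite ?nnegrE.
    - exact: ltW.
    - by rewrite addr_ge0// lnorm_ge0.
    - by rewrite mulr_ge0 ?addr_ge0// ltW.
    - by rewrite mulrDr mulr1 lerD ?norm1_le_norm2// ler1n.
  have A0 : 0 <= A by rewrite mulr_ge0 ?powR_ge0// ltW.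
  have phiw k : `|phi (of_lattice R k)| * w k <= A by rewrite -ler_pdivlMr.
  have phiS : sums_le setT (fun k => `|phi (of_lattice R k)| * 1) (A * S).
    move=> s us sD; apply: le_trans (ler_wpM2l A0 (sS s us sD)).
    rewrite mulr_sumr; apply: ler_sum => k _.
    by rewrite mulr1 -wV phiA.
  (* The cap 1 on the rate is arbitrary, since a power weight is dominated by every growing
     exponential. *)
  have [d /andP[d0 _] logP] := log_omega_weighted phi_pos (weights_K vw) ltr01
    (fun=> lexx 1) phiS.
  have [C C1 wC] := pow_weight_growth n.+1 a0 d0.
  have vC k : 1 <= C * expR (d * lnorm R (k : 'rV[int]_n.+1)).
    rewrite mulr_ege1// -[leLHS]expR0 ler_expR mulr_ge0 ?lnorm_ge0//.
    exact: ltW.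
  have [a aP] := logP (fun=> 1) w A C vw (fun=> lexx 1) phiw vC wC.
  have [a' a'0 omegaP] := approximable_omega_plus vw aP.
  pose C2 := a' ^+ 2 * (2 `^ alpha * (2 * (S + 1))).
  exists a', C2; split => //.
    by rewrite !mulr_gt0 ?exprn_gt0 ?powR_gt0//; lra.
  move=> H.
  have w_norm2 k : (w k)^-1 <= (1 + norm2 (of_lattice R k)) `^ (- alpha).
    rewrite powRN lef_pV2 ?posrE ?powR_gt0 ?ltr_pwDl ?norm2_ge0 ?lnorm_ge0//.
    apply: ge0_ler_powR; rewrite ?nnegrE ?addr_ge0 ?norm2_ge0 ?lnorm_ge0//.
      exact: ltW.
    by rewrite lerD2l norm2_le_norm1.
  split=> [k _|j k _ _]; rewrite cabsE lecR.
    apply: le_trans (ler_wpM2l (ltW a'0) (w_norm2 k)).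
    by rewrite ler_pdivlMr// (gamma_sup vw (omegaP H)).
  have sS1 : sums_le setT (fun l : 'rV[int]_n.+1 =>
      (1 + lnorm R l) `^ (- alpha)) (S + 1).
    by move=> s us sD; apply: le_trans (sS s us sD) _; rewrite lerDl.
  apply: le_trans (semi_coef_bound vw (omegaP H) w0
    (pow_kernel (D := _) j k (ltW a0) sS1)) _.
  have -> : a' ^+ 2 * (2 `^ alpha / w (k - j) * (2 * (S + 1))) =
    C2 * (w (k - j))^-1 by rewrite /C2; ring.
  rewrite ler_wpM2l ?w_norm2// !mulr_ge0 ?exprn_ge0 ?powR_ge0 ?(ltW a'0)//.
  lra.
- move=> alpha a0 [C0 C00 phiP] H.
  (* Half of the decay of [phi] is kept for the weight and half makes the weighted sum converge; it
     also forces beta <= alpha / 2 < alpha. *)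
  pose v0 k : R := exp_weight (alpha / 2) (k : 'rV[int]_n.+1).
  have a2 : 0 < alpha / 2 by lra.
  have v01 k : 1 <= v0 k := weights_v1 (exp_weights n.+1 (ltW a2)) k.
  have [S0 sS0] := sums_le_expR n.+1 a2.
  have phiS : sums_le setT (fun k => `|phi (of_lattice R k)| * v0 k) (C0 * S0).
    move=> s us sD; apply: le_trans (ler_wpM2l (ltW C00) (sS0 s us sD)).
    rewrite mulr_sumr; apply: ler_sum => k _.
    apply: le_trans (ler_wpM2r (expR_ge0 _) (phiP _)) _.
    rewrite -(mulrA C0) -expRD -[norm1 _]/(lnorm R k).
    rewrite ler_wpM2l ?(ltW C00)// ler_expR.
    lra.
  have [b /andP[b0 b2] logP] := log_omega_weighted phi_pos (lexx 1) a2 v01 phiS.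
  have vw := exp_weights n.+1 (ltW b0).
  pose v k : R := exp_weight b (k : 'rV[int]_n.+1).
  have v_gt0 k : 0 < v k by exact: expR_gt0.
  have vv0 k : v k <= v0 k by rewrite ler_expR ler_wpM2r ?lnorm_ge0.
  have phiv k : `|phi (of_lattice R k)| * v k <= C0.
    apply: le_trans (ler_wpM2r (expR_ge0 _) (phiP _)) _.
    rewrite -(mulrA C0) -expRD -[norm1 _]/(lnorm R k).
    rewrite ler_piMr ?(ltW C00)//.
    rewrite -expR0 ler_expR.
    have := lnorm_ge0 R k; nra.
  have vC k : v k <= 1 * expR (b * lnorm R k) by rewrite mul1r.
  have [a aP] := logP v v C0 1 vw vv0 phiv vC vC.
  have [a' a'0 omegaP] := approximable_omega_plus vw aP.
  exists b, a'; split => //; first by rewrite b0; lra.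
    move=> k _; rewrite cabsE lecR mulNr expRN ler_pdivlMr ?expR_gt0//.
    exact: (gamma_sup vw (omegaP H)).
  move=> b' b'b.
  have bb' : 0 < b - b' by rewrite subr_gt0; case/andP: b'b.
  have [S sS] := sums_le_expR n.+1 bb'.
  have S0' : 0 <= S by have := sS [::]; rewrite big_nil; apply.
  have sS1 : sums_le setT (fun l : 'rV[int]_n.+1 =>
      expR (- (b - b') * lnorm R l)) (S + 1).
    by move=> s us sD; apply: le_trans (sS s us sD) _; rewrite lerDl.
  exists (a' ^+ 2 * (2 * (S + 1))); split.
  - by rewrite !mulr_gt0 ?exprn_gt0//; lra.
  - move=> j k _ _; rewrite cabsE lecR.
    apply: le_trans (semi_coef_bound vw (omegaP H) v_gt0
      (exp_kernel (D := _) j k b'b sS1)) _.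
    by rewrite mulrCA mulrC.
  - move=> HU j k _ _; rewrite cabsE lecR.
    have := exp_kernel_upper (j := j) (k := k) b'b sS1; rewrite -HU => kern.
    apply: le_trans (semi_coef_bound vw (omegaP H) v_gt0 kern) _.
    by rewrite mulrCA mulrC.
Qed.
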